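(* 1. Let $M$ be a smooth manifold, let $X_1,X_2,X_3,X_4$ be vector fields on $M$ and let $X_{i,V}$ be the vertical lift of $X_i$ to $TM$ for $i=1,2,3,4$. Then $$\pi_{X_{1,V},X_{2,V},X_{3,V},X_{4,V}}=X_{1,V}\wedge X_{2,V}+X_{3,V}\wedge X_{4,V}$$ is a Poisson tensor on $TM$. 2. Let $(M,\pi)$ be a Poisson manifold, let $c$ be a Casimir function for $\pi$, and let $\lambda\in\mathbb{R}$. For any Poisson vector fields $X_1,X_2,X_3,X_4$ on $M$, with vertical lifts $X_{i,V}$, $$\pi_{TM,X_{1,V},X_{2,V},X_{3,V},X_{4,V},c}=\pi_{TM}+\lambda\, c(\mathbf{x})\left(X_{1,V}\wedge X_{2,V}+X_{3,V}\wedge X_{4,V}\right)$$ is a Poisson tensor on $TM$.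
   Context: All manifolds, functions and tensors are smooth. A bivector field $P$ is a Poisson tensor if the bracket $\{f,g\}=P(df,dg)$ satisfies the Jacobi identity (equivalently, the Schouten--Nijenhuis bracket $[P,P]$ vanishes). On a Poisson manifold $(M,\pi)$ with $\{f,g\}=\pi(df,dg)$, a Casimir function is a $c\in C^\infty(M)$ with $\{\cdot,c\}=0$, and a Poisson vector field is a vector field $X$ with $\mathcal{L}_X\pi=0$. Local coordinates $\mathbf{x}=(x^1,\dots,x^N)$ on $M$ induce coordinates $(\mathbf{x},\mathbf{y})=(x^1,\dots,x^N,y^1,\dots,y^N)$ on $TM$, where $y^i$ is the fiber-wise linear function defined by $dx^i$. With $\pi^{ij}=\{x^i,x^j\}$, the Poisson tensor on $TM$ induced by $\pi$ is $$\pi_{TM}(\mathbf{x},\mathbf{y})=\sum_{i,j} \pi^{ij}(\mathbf{x})\frac{\partial}{\partial x^i}\wedge \frac{\partial}{\partial y^j}+\frac12\sum_{i,j,s}\frac{\partial\pi^{ij}}{\partial x^s}(\mathbf{x})\,y^s\frac{\partial}{\partial y^i}\wedge \frac{\partial}{\partial y^j}.$$ For $X=\sum_i v^i(\mathbf{x})\frac{\partial}{\partial x^i}$ the vertical lift is the vector field $X_{V}=\sum_{i} v^i(\mathbf{x})\frac{\partial}{\partial y^i}$ on $TM$; $X_{i,V}$ denotes $(X_i)_V$. The factor $c(\mathbf{x})$ on $TM$ means $c\circ q_M$, with $q_M:TM\to M$ the projection. *)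

(* Defs.v *)
From HB Require Import structures.
From mathcomp Require Import all_boot all_order all_algebra.
From mathcomp Require Import all_classical all_reals all_analysis.

Set Implicit Arguments.
Unset Strict Implicit.
Unset Printing Implicit Defensive.

Import Order.TTheory GRing.Theory Num.Theory.
Import numFieldNormedType.Exports.

Local Open Scope classical_set_scope.
Local Open Scope ring_scope.

Definition basis_rV (R : realType) (n : nat) (k : 'I_n) : 'rV[R]_n :=
  delta_mx 0 k.

(* Class C^r on an open set U: a map is C^(r+1) when it is differentiable and  *)
(* all its partial derivatives are C^r. All analytic notions only depend on   *)
(* the germ of f at the points of U.                                          *)
Fixpoint Ck_on (R : realType) (n : nat) (V : normedModType R) (r : nat)
    (U : set 'rV[R]_n) (f : 'rV[R]_n -> V) : Prop :=
  match r with
  | 0%N => forall x, U x -> {for x, continuous f}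
  | r'.+1 => (forall x, U x -> differentiable f x) /\
             (forall k : 'I_n, Ck_on r' U (fun x => 'D_(basis_rV R k) f x))
  end.

Definition smooth_on (R : realType) (n : nat) (V : normedModType R)
    (U : set 'rV[R]_n) (f : 'rV[R]_n -> V) : Prop :=
  forall r, Ck_on r U f.

Section SmoothCalculus.
Variables (R : realType) (n : nat).
Implicit Types (V W : normedModType R) (U : set 'rV[R]_n).

Lemma near_eq_differentiable V W (f g : V -> W) x :
  (\near x, f x = g x) -> differentiable f x -> differentiable g x.
Proof.
move=> fg df; have fgx := nbhs_singleton fg.
have H : g \o shift x = cst (g x) + 'd f x +o_ 0 id.
  apply/eqaddoP => e e0.
  have /eqaddoP/(_ e e0) Hf := diff_locally df.
  have fg0 : \forall h \near 0, f (h + x) = g (h + x).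
    by move: fg; rewrite (near_shift 0 x) /= subr0.
  near=> h.
  have E : (f \o shift x - (cst (f x) + 'd f x)) h =
           (g \o shift x - (cst (g x) + 'd f x)) h.
    by rewrite !fctE /= fgx (near fg0 h).
  by rewrite -E; near: h.
have dfc := diff_continuous df.
apply/diff_locallyP; rewrite (diff_unique dfc H); split => //.
Unshelve. all: by end_near. Qed.

Lemma near_eq_continuous_at (T : topologicalType) V (f g : T -> V) x :
  (\near x, f x = g x) -> {for x, continuous f} -> {for x, continuous g}.
Proof.
move=> fg fc; rewrite /prop_for /continuous_at -(nbhs_singleton fg).
apply: cvg_trans fc; exact: near_eq_cvg.
Qed.

Lemma Ck_on_ext V r U (f g : 'rV[R]_n -> V) : open U ->
  (forall x, U x -> f x = g x) -> Ck_on r U f -> Ck_on r U g.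
Proof.
move=> oU; elim: r f g => [|r IH] f g fg /=.
  move=> fc x Ux; apply: near_eq_continuous_at (fc x Ux).
  by apply: filterS (open_nbhs_nbhs (conj oU Ux)) => y /fg.
have nfg x : U x -> \near x, f x = g x.
  by move=> Ux; apply: filterS (open_nbhs_nbhs (conj oU Ux)) => y /fg.
case=> df Df; split=> [x Ux|k]; first exact: near_eq_differentiable (nfg x Ux) (df x Ux).
by apply: IH (Df k) => x Ux; apply: near_eq_derive; exact: nfg.
Qed.

Lemma Ck_onW V r U (f : 'rV[R]_n -> V) : Ck_on r.+1 U f -> Ck_on r U f.
Proof.
elim: r f => [|r IH] f.
  by case=> df _ x Ux; apply: differentiable_continuous; exact: df.
by case=> df Df; split=> // k; exact: IH.
Qed.

Lemma Ck_on_sub V r U U' (f : 'rV[R]_n -> V) :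
  U' `<=` U -> Ck_on r U f -> Ck_on r U' f.
Proof.
move=> UU'; elim: r f => [|r IH] f /=; first by move=> fc x /UU'; exact: fc.
by case=> df Df; split=> [x /UU'|k]; [exact: df|exact: IH (Df k)].
Qed.

Lemma Ck_on_cst V r U (v : V) : Ck_on r U (fun=> v).
Proof.
elim: r v => [|r IH] v /=; first by move=> x _; exact: cst_continuous.
split=> [x _|k]; first exact: differentiable_cst.
have -> : (fun x : 'rV[R]_n => 'D_(basis_rV R k) (fun=> v) x) = (fun=> 0).
  by apply/funext => x; rewrite derive_cst.
exact: IH.
Qed.

Lemma Ck_onD V r U (f g : 'rV[R]_n -> V) : open U ->
  Ck_on r U f -> Ck_on r U g -> Ck_on r U (fun x => f x + g x).
Proof.
move=> oU; elim: r f g => [|r IH] f g /=.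
  by move=> fc gc x Ux; apply: continuousD; [exact: fc|exact: gc].
case=> df Df [dg Dg]; split=> [x Ux|k].
  by apply: differentiableD; [exact: df|exact: dg].
apply: (@Ck_on_ext _ _ _ (fun x => 'D_(basis_rV R k) f x + 'D_(basis_rV R k) g x)) => //.
  move=> x Ux; rewrite deriveD//; apply: diff_derivable; [exact: df|exact: dg].
exact: IH.
Qed.

Lemma Ck_on_sum V r U (I : Type) (s : seq I) (F : I -> 'rV[R]_n -> V) :
  open U -> (forall i, Ck_on r U (F i)) ->
  Ck_on r U (fun x => \sum_(i <- s) F i x).
Proof.
move=> oU HF; elim: s => [|i s IH].
  by under eq_fun do rewrite big_nil; exact: Ck_on_cst.
by under eq_fun do rewrite big_cons; exact: Ck_onD.
Qed.

Lemma Ck_on_linear V W r U (L : {linear V -> W}) (f : 'rV[R]_n -> V) :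
  open U -> continuous L -> Ck_on r U f -> Ck_on r U (fun x => L (f x)).
Proof.
move=> oU Lc; have dL y : differentiable L y by exact: linear_differentiable.
elim: r f => [|r IH] f /=.
  by move=> fc x Ux; apply: continuous_comp; [exact: fc|exact: Lc].
case=> df Df; split=> [x Ux|k].
  by apply: (@differentiable_comp _ _ _ _ f L); [exact: df|exact: dL].
apply: (@Ck_on_ext _ _ _ (fun x => L ('D_(basis_rV R k) f x))) => //; last exact: IH.
move=> x Ux; have dfx := df x Ux.
have dLf : differentiable (L \o f) x by exact: differentiable_comp.
rewrite deriveE// (deriveE (f := fun x => L (f x)) _ dLf).
have E := @diff_lin _ _ _ L (f x) Lc.
by rewrite (diff_comp dfx (dL (f x)))/= E.
Qed.

Lemma scale_is_bilinear V :
  bilinear_for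
    (GRing.Scale.Law.clone _ _ *:%R _) (GRing.Scale.Law.clone _ _ *:%R _)
    (@GRing.scale R V : R -> V -> V).
Proof.
split=> [u'|u] a x y /=.
- by rewrite scalerDl scalerA.
- by rewrite scalerDr !scalerA mulrC.
Qed.
Lemma is_diff_scale2 V W (a : W -> R) (f : W -> V) x :
 differentiable a x -> differentiable f x ->
 is_diff x (fun y => a y *: f y)
   (fun h => a x *: 'd f x h + 'd a x h *: f x).
Proof.
move=> da df.
pose bM := bilinear_isBilinear.Build R R V V _ _ (@GRing.scale R V) (scale_is_bilinear V).
pose B : {bilinear R -> V -> V} := HB.pack (@GRing.scale R V : R -> V -> V) bM.
have Bc : continuous (fun p : R * V => B p.1 p.2) by exact: scale_continuous.
have H1 : is_diff (a x, f x) (fun p : R * V => B p.1 p.2)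
    (fun q : R * V => B (a x) q.2 + B q.1 (f x)).
  by apply: DiffDef; [exact: differentiable_bilin|exact: diff_bilin].
have H2 := is_diff_pair (differentiableP da) (differentiableP df).
exact: (is_diff_comp H2 H1).
Qed.

Lemma Ck_onZ V r U (a : 'rV[R]_n -> R) (f : 'rV[R]_n -> V) : open U ->
  Ck_on r U a -> Ck_on r U f -> Ck_on r U (fun x => a x *: f x).
Proof.
move=> oU; elim: r a f => [|r IH] a f.
  by move=> ac fc x Ux; apply: continuousZ; [exact: ac|exact: fc].
move=> Ca Cf; have [da Da] := Ca; have [df Df] := Cf.
have dZ x (Ux : U x) := is_diff_scale2 (da x Ux) (df x Ux).
split=> [x Ux|k]; first exact: (@ex_diff _ _ _ _ _ _ _ (dZ x Ux)).
apply: (@Ck_on_ext _ _ _ (fun x => a x *: 'D_(basis_rV R k) f x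
   + 'D_(basis_rV R k) a x *: f x)) => //.
  move=> x Ux; rewrite (deriveE _ (df x Ux)) (deriveE _ (da x Ux)).
  rewrite (deriveE _ (@ex_diff _ _ _ _ _ _ _ (dZ x Ux))).
  by rewrite (@diff_val _ _ _ _ _ _ _ (dZ x Ux)).
apply: Ck_onD => //; apply: IH.
- exact: Ck_onW Ca.
- exact: Df k.
- exact: Da k.
- exact: Ck_onW Cf.
Qed.

End SmoothCalculus.

Section LinearMaps.
Variables (R : realType) (n : nat).

Lemma derive_basis (V : normedModType R) (f : 'rV[R]_n -> V) x (v : 'rV[R]_n) :
  differentiable f x ->
  'D_v f x = \sum_(k < n) v 0 k *: 'D_(basis_rV R k) f x.
Proof.
move=> df; rewrite deriveE// [in LHS](row_sum_delta v) linear_sum.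
by apply: eq_bigr => k _; rewrite linearZ deriveE.
Qed.

Lemma Ck_on_comp_linear m (V : normedModType R) r (U : set 'rV[R]_n)
    (f : 'rV[R]_n -> V) (L : {linear 'rV[R]_m -> 'rV[R]_n}) :
  open U -> continuous L -> Ck_on r U f ->
  Ck_on r (L @^-1` U) (fun z => f (L z)).
Proof.
move=> oU Lc; have oLU : open (L @^-1` U) by apply: open_comp => // z _; exact: Lc.
elim: r f => [|r IH] f /=.
  by move=> fc z Uz; apply: continuous_comp; [exact: Lc|exact: fc].
case=> df Df; split=> [z Uz|k].
  apply: (@differentiable_comp _ _ _ _ L f); last exact: df.
  exact: linear_differentiable.
apply: (@Ck_on_ext _ _ _ _ _ (fun z =>
  \sum_(j < n) (L (basis_rV R k) : 'rV[R]_n) 0 j *: 'D_(basis_rV R j) f (L z))) => //.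
  move=> z Uz; have dLz : differentiable L z by exact: linear_differentiable.
  have dfL : differentiable (f \o L) z by apply: differentiable_comp => //; exact: df.
  rewrite (deriveE (f := fun z => f (L z)) _ dfL).
  rewrite (diff_comp dLz (df _ Uz))/= (@diff_lin _ _ _ L z Lc).
  by rewrite -(derive_basis _ (df _ Uz)) deriveE//; exact: df.
apply: Ck_on_sum => // j; apply: Ck_onZ => //; first exact: Ck_on_cst.
exact: IH (Df j).
Qed.

Lemma coord_is_linear m (k : 'I_m) :
  linear (fun x : 'rV[R]_m => x 0 k : R^o).
Proof. by move=> a x y; rewrite !mxE. Qed.

Lemma Ck_on_coord m r (U : set 'rV[R]_n) (f : 'rV[R]_n -> 'rV[R]_m) (k : 'I_m) :
  open U -> Ck_on r U f -> Ck_on r U (fun x => f x 0 k : R).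
Proof.
move=> oU.
pose LM := GRing.isLinear.Build _ _ _ _ _ (coord_is_linear k).
pose L : {linear 'rV[R]_m -> R} := HB.pack (fun x : 'rV[R]_m => x 0 k : R) LM.
by apply: (@Ck_on_linear _ _ _ _ _ _ L) => //; exact: coord_continuous.
Qed.

Lemma Ck_on_mulmxr m l r (U : set 'rV[R]_n) (f : 'rV[R]_n -> 'rV[R]_m)
    (A : 'M[R]_(m, l)) :
  open U -> Ck_on r U f -> Ck_on r U (fun x => f x *m A).
Proof.
move=> oU Cf; under eq_fun do rewrite mulmx_sum_row.
apply: Ck_on_sum => // k; apply: Ck_onZ => //; first exact: Ck_on_coord.
exact: Ck_on_cst.
Qed.

Lemma Ck_on_id r (U : set 'rV[R]_n) : Ck_on r U id.
Proof.
case: r => [|r] /=; first by move=> x _ A.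
split=> [x _|k]; first exact: (@ex_diff _ _ _ _ _ _ _ (is_diff_id x)).
have -> : (fun x : 'rV[R]_n => 'D_(basis_rV R k) id x) = (fun=> basis_rV R k).
  by apply/funext => x; rewrite derive_id.
exact: Ck_on_cst.
Qed.

Lemma second_countable_rV : @second_countable 'rV[R]_n.
Proof.
pose F (ce : 'rV[rat]_n * rat) : set 'rV[R]_n :=
  if 0 < ce.2 then ball (map_mx (ratr : rat -> R) ce.1) (ratr ce.2) else set0.
exists (range F).
  by apply: sub_countable (card_image_le F setT) _; exact: countableP.
split=> [A [ce _ <-]|x A].
  rewrite /F; case: ifPn => [e0|_]; last exact: open0.
  by apply: ball_open; rewrite ltr0q.
move/nbhs_ballP => [e /= e0 xeA].
have e20 : (0 : R) < e / 2 by rewrite divr_gt0.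
have [q] := rat_in_itvoo e20; rewrite in_itv/= => /andP[q0 qe].
have H k : exists c : rat, `|x 0 k - ratr c| < ratr q.
  have : x 0 k - ratr q < x 0 k + ratr q by rewrite ltrBlDr -addrA ltrDl addr_gt0.
  move=> /rat_in_itvoo[c]; rewrite in_itv/= => /andP[xc cx].
  by exists c; rewrite ltr_distlC xc cx.
have [c Hc] := choice H.
have Fe : F (\row_k c k, q) = ball (map_mx (ratr : rat -> R) (\row_k c k)) (ratr q).
  by rewrite /F/=; move: q0; rewrite ltr0q => ->.
have xF : ball (map_mx (ratr : rat -> R) (\row_k c k)) (ratr q) x.
  split; first exact: q0.
  by move=> i j; rewrite !mxE ord1 /ball/= distrC; exact: Hc.
exists (F (\row_k c k, q)); first by rewrite /= Fe; split=> //; exists (\row_k c k, q).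
rewrite Fe => y /= cy; apply: xeA.
have := ball_triangle (ball_sym xF) cy.
by apply: le_ball; rewrite [leRHS](splitr e) lerD// ltW.
Qed.

End LinearMaps.

(* Smooth manifold of dimension n: a Hausdorff second countable space with a  *)
(* smooth atlas. The function chart_at selects a chart around each point; it  *)
(* witnesses that the charts cover, and tangent vectors at p are represented  *)
(* by their coordinates in the chart chart_at p.                              *)
Record manifold (R : realType) (n : nat) := Manifold {
  mspace :> topologicalType;
  mspace_hausdorff : hausdorff_space mspace;
  mspace_second_countable : @second_countable mspace;
  chart_index : Type;
  chart_dom : chart_index -> set mspace;
  chart_range : chart_index -> set 'rV[R]_n;
  chart : chart_index -> mspace -> 'rV[R]_n;
  chart_inv : chart_index -> 'rV[R]_n -> mspace;
  chart_dom_open : forall i, open (chart_dom i);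
  chart_range_open : forall i, open (chart_range i);
  chart_in_range : forall i p, chart_dom i p -> chart_range i (chart i p);
  chart_inv_dom : forall i x, chart_range i x -> chart_dom i (chart_inv i x);
  chartK : forall i p, chart_dom i p -> chart_inv i (chart i p) = p;
  chart_invK : forall i x, chart_range i x -> chart i (chart_inv i x) = x;
  chart_continuous : forall i p, chart_dom i p -> {for p, continuous (chart i)};
  chart_inv_continuous :
    forall i x, chart_range i x -> {for x, continuous (chart_inv i)};
  transition_smooth : forall i j,
    smooth_on (chart_range i `&` chart_inv i @^-1` chart_dom j) (chart j \o chart_inv i);
  chart_at : mspace -> chart_index;
  chart_at_dom : forall p, chart_dom (chart_at p) p
}.

(* Row-vector convention: the vector with coordinates v in chart i has        *)
(* coordinates v *m transition_jacobian i j p in chart j.                     *)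
Definition transition_jacobian (R : realType) (n : nat) (M : manifold R n)
    (i j : chart_index M) (p : M) : 'M[R]_n :=
  jacobian (chart j \o chart_inv i) (chart i p).

Section ManifoldTheory.
Variables (R : realType) (n : nat) (M : manifold R n).
Implicit Types (i j k : chart_index M) (p : M).

Lemma open_chart_inv_preimage i (A : set M) :
  open A -> open (chart_range i `&` chart_inv i @^-1` A).
Proof.
move=> oA; rewrite openE => x [cx Ax]; rewrite /interior; apply: filterI.
  by apply: open_nbhs_nbhs; split => //; exact: chart_range_open.
apply: (chart_inv_continuous cx); exact: open_nbhs_nbhs.
Qed.

Lemma transition_differentiable i j x :
  (chart_range i `&` chart_inv i @^-1` chart_dom j) x ->
  differentiable (chart j \o chart_inv i : 'rV[R]_n -> 'rV[R]_n) x.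
Proof. by move=> Ux; have [+ _] := transition_smooth i j 1; exact. Qed.

Lemma transition_jacobian_comp i j k p : chart_dom i p -> chart_dom j p -> chart_dom k p ->
  transition_jacobian i k p =
  transition_jacobian i j p *m transition_jacobian j k p.
Proof.
move=> ip jp kp; rewrite /transition_jacobian.
set x := chart i p; have cx : chart_range i x by exact: chart_in_range.
have xp : chart_inv i x = p by exact: chartK.
have Uij : (chart_range i `&` chart_inv i @^-1` chart_dom j) x by split; rewrite //= xp.
have Uik : (chart_range i `&` chart_inv i @^-1` chart_dom k) x by split; rewrite //= xp.
have yx : chart j p = (chart j \o chart_inv i) x by rewrite /= xp.
have Ujk : (chart_range j `&` chart_inv j @^-1` chart_dom k) ((chart j \o chart_inv i) x).
  by rewrite -yx; split; [exact: chart_in_range|rewrite /= chartK].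
have dij := transition_differentiable Uij.
have dik := transition_differentiable Uik.
have djk := transition_differentiable Ujk.
apply/row_matrixP => a; rewrite row_mul.
rewrite [X in X = _]rowE.
rewrite [X in _ = X *m _]rowE.
rewrite yx -[X in X = _](deriveEjacobian _ dik).
rewrite -[X in _ = X *m _](deriveEjacobian _ dij).
rewrite -[X in _ = X](deriveEjacobian _ djk).
have -> : 'D_(delta_mx 0 a) (chart k \o chart_inv i) x =
   'D_(delta_mx 0 a) ((chart k \o chart_inv j) \o (chart j \o chart_inv i)) x.
  apply: near_eq_derive.
  have nU : nbhs x (chart_range i `&` chart_inv i @^-1` chart_dom j).
    by apply: open_nbhs_nbhs; split => //; exact/open_chart_inv_preimage/chart_dom_open.
  apply: filterS nU.
  by move=> y [_ /= jy]; rewrite chartK.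
have dc := differentiable_comp dij djk.
by rewrite (deriveE _ dc) (diff_comp dij djk)/= (deriveE _ dij) (deriveE _ djk).
Qed.

Lemma transition_jacobian_id i p : chart_dom i p -> transition_jacobian i i p = 1%:M.
Proof.
move=> ip; rewrite /transition_jacobian.
have cx : chart_range i (chart i p) by exact: chart_in_range.
have Uii : (chart_range i `&` chart_inv i @^-1` chart_dom i) (chart i p).
  by split => //=; rewrite chartK.
have dii := transition_differentiable Uii.
apply/row_matrixP => a; rewrite !rowE mulmx1 -(deriveEjacobian _ dii).
rewrite -[RHS](derive_id (chart i p)); apply: near_eq_derive.
have nU : nbhs (chart i p) (chart_range i).
  by apply: open_nbhs_nbhs; split => //; exact: chart_range_open.
apply: filterS nU => y /= cy.
by rewrite chart_invK.
Qed.

End ManifoldTheory.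

(* The set underlying TM: the pair (p, v) is the tangent vector at p whose    *)
(* coordinates in the chart chart_at p are v. Its topology and atlas are not  *)
(* those of a product; they come from the induced charts (x, y) below.        *)
Definition tangent_space (R : realType) (n : nat) (M : manifold R n) : Type :=
  (M * 'rV[R]_n)%type.

HB.instance Definition _ (R : realType) (n : nat) (M : manifold R n) :=
  Choice.on (tangent_space M).

Section TangentBundle.
Variables (R : realType) (n : nat) (M : manifold R n).
Local Notation TM := (tangent_space M).
Local Notation J := transition_jacobian.
Implicit Types (i j k : chart_index M) (w : TM).

Definition tangent_proj w : M := w.1.

(* The coordinates y of w, i.e. the values at w of the forms dx.              *)
Definition tangent_coord i w : 'rV[R]_n :=
  w.2 *m J (chart_at (tangent_proj w)) i (tangent_proj w).

Definition tangent_dom i : set TM := tangent_proj @^-1` chart_dom i.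

Definition tangent_cod i : set 'rV[R]_(n + n) := lsubmx @^-1` chart_range i.

Definition tangent_chart i w : 'rV[R]_(n + n) :=
  row_mx (chart i (tangent_proj w)) (tangent_coord i w).

Definition tangent_chart_inv i (z : 'rV[R]_(n + n)) : TM :=
  let p := chart_inv i (lsubmx z) in (p, rsubmx z *m J i (chart_at p) p).

Definition tangent_open (A : set TM) :=
  forall i, open (tangent_cod i `&` tangent_chart_inv i @^-1` A).

Lemma tangent_cod_open i : open (tangent_cod i).
Proof.
by apply: open_comp; [move=> z _; exact: continuous_lsubmx|exact: chart_range_open].
Qed.

Lemma tangent_openT : tangent_open setT.
Proof. by move=> i; rewrite preimage_setT setIT; exact: tangent_cod_open. Qed.

Lemma tangent_openI : setI_closed tangent_open.
Proof.
move=> A B oA oB i; rewrite preimage_setI -(setIid (tangent_cod i)) setIACA.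
exact: openI.
Qed.

Lemma tangent_open_bigU (I : Type) (f : I -> set TM) :
  (forall a, tangent_open (f a)) -> tangent_open (\bigcup_a f a).
Proof.
move=> of_ i; rewrite preimage_bigcup setI_bigcupr.
by apply: bigcup_open => a _; exact: of_.
Qed.

HB.instance Definition _ := isOpenTopological.Build TM
  tangent_openT tangent_openI tangent_open_bigU.

Lemma tangent_openE (A : set TM) : open A = tangent_open A.
Proof. by []. Qed.

Lemma tangent_chart_cod i w : tangent_dom i w -> tangent_cod i (tangent_chart i w).
Proof. by move=> iw; rewrite /tangent_cod/= row_mxKl; exact: chart_in_range. Qed.

Lemma tangent_chart_inv_dom i z :
  tangent_cod i z -> tangent_dom i (tangent_chart_inv i z).
Proof. exact: chart_inv_dom. Qed.

Lemma tangent_chartK i w :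
  tangent_dom i w -> tangent_chart_inv i (tangent_chart i w) = w.
Proof.
case: w => p v ip; rewrite /tangent_chart_inv /tangent_chart row_mxKl row_mxKr.
rewrite /tangent_coord /= chartK//; congr (_, _).
have cp := chart_at_dom p.
by rewrite -mulmxA -transition_jacobian_comp// transition_jacobian_id// mulmx1.
Qed.

Lemma tangent_transitionE i j z :
  (tangent_cod i `&` tangent_chart_inv i @^-1` tangent_dom j) z ->
  tangent_chart j (tangent_chart_inv i z) =
  row_mx ((chart j \o chart_inv i) (lsubmx z))
    ('D_(rsubmx z) (chart j \o chart_inv i) (lsubmx z)).
Proof.
move=> [cz jz]; rewrite /tangent_chart /tangent_coord /=.
set p := chart_inv i (lsubmx z).
have ip : chart_dom i p by exact: chart_inv_dom.
have cp := chart_at_dom p.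
rewrite -mulmxA -transition_jacobian_comp// deriveEjacobian; last first.
  by apply: transition_differentiable; split.
by rewrite /transition_jacobian /p chart_invK.
Qed.

Lemma tangent_chart_invK i z :
  tangent_cod i z -> tangent_chart i (tangent_chart_inv i z) = z.
Proof.
move=> cz; rewrite /tangent_chart /tangent_coord /=.
have ip : chart_dom i (chart_inv i (lsubmx z)) by exact: chart_inv_dom.
have cp := chart_at_dom (chart_inv i (lsubmx z)).
rewrite -mulmxA -transition_jacobian_comp// transition_jacobian_id// mulmx1.
by rewrite chart_invK// hsubmxK.
Qed.

Lemma tangent_preimage_open (A : set M) :
  open A -> tangent_open (tangent_proj @^-1` A).
Proof.
move=> oA i.
rewrite [X in open X](_ : _ = lsubmx @^-1` (chart_range i `&` chart_inv i @^-1` A))//.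
apply: open_comp; first by move=> z _; exact: continuous_lsubmx.
exact: open_chart_inv_preimage.
Qed.

Lemma tangent_dom_open i : open (tangent_dom i).
Proof. exact: tangent_preimage_open (chart_dom_open i). Qed.

Lemma tangent_transition_smooth i j :
  smooth_on (tangent_cod i `&` tangent_chart_inv i @^-1` tangent_dom j)
    (tangent_chart j \o tangent_chart_inv i).
Proof.
move=> r; set U := (X in Ck_on _ X).
have oU : open U by exact: tangent_dom_open.
pose U0 := chart_range i `&` chart_inv i @^-1` chart_dom j.
have oU0 : open U0 by exact: open_chart_inv_preimage (chart_dom_open j).
pose tau : 'rV[R]_n -> 'rV[R]_n := chart j \o chart_inv i.
pose L : {linear 'rV[R]_(n + n) -> 'rV[R]_n} := lsubmx.
have Lc : continuous L by exact: continuous_lsubmx.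
have [_ Dtau] := transition_smooth i j r.+1.
have Ctau : Ck_on r U (fun z => tau (L z)).
  exact: (Ck_on_comp_linear oU0 Lc (transition_smooth i j r)).
have CDtau : Ck_on r U (fun z : 'rV[R]_(n + n) =>
    \sum_(k < n) (rsubmx z) 0 k *: 'D_(basis_rV R k) tau (L z)).
  apply: Ck_on_sum => // k; apply: Ck_onZ => //; last first.
    exact: (Ck_on_comp_linear oU0 Lc (Dtau k)).
  under eq_fun do rewrite mxE.
  by apply: Ck_on_coord => //; exact: Ck_on_id.
apply: (@Ck_on_ext _ _ _ _ _ (fun z =>
    tau (L z) *m row_mx 1%:M 0 +
    (\sum_(k < n) (rsubmx z) 0 k *: 'D_(basis_rV R k) tau (L z))
      *m row_mx 0 1%:M)) => //.
  move=> z Uz; rewrite /= tangent_transitionE// derive_basis; last first.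
    exact: transition_differentiable.
  by rewrite !mul_mx_row !mulmx1 !mulmx0 add_row_mx addr0 add0r.
by apply: Ck_onD => //; apply: Ck_on_mulmxr.
Qed.

Lemma tangent_chart_continuous i w :
  tangent_dom i w -> {for w, continuous (tangent_chart i)}.
Proof.
move=> iw; rewrite /prop_for /continuous_at => A /=.
rewrite nbhsE => -[B [oB Bw] BA].
have : open (tangent_dom i `&` tangent_chart i @^-1` B).
  rewrite tangent_openE => j.
  rewrite [X in open X](_ : _ = (tangent_cod j `&` tangent_chart_inv j @^-1` tangent_dom i)
     `&` (tangent_chart i \o tangent_chart_inv j) @^-1` B); last first.
    by rewrite preimage_setI setIA.
  rewrite openE => z [Uz Bz]; apply: filterI.
    by apply: open_nbhs_nbhs; split => //; exact: tangent_dom_open.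
  have tc := @tangent_transition_smooth j i 0%N z Uz.
  by apply: tc; exact: open_nbhs_nbhs.
move=> oC; rewrite nbhs_simpl/= nbhsE; exists (tangent_dom i `&` tangent_chart i @^-1` B).
  by split.
by move=> w' [_ /BA].
Qed.

Lemma tangent_chart_inv_continuous i z :
  tangent_cod i z -> {for z, continuous (tangent_chart_inv i)}.
Proof.
move=> cz; rewrite /prop_for /continuous_at => A /=.
rewrite nbhsE => -[B [oB Bw] BA].
rewrite nbhs_simpl/= nbhsE; exists (tangent_cod i `&` tangent_chart_inv i @^-1` B).
  by split; [exact: oB|split].
by move=> w' [_ /BA].
Qed.

Lemma tangent_hausdorff : hausdorff_space TM.
Proof.
rewrite open_hausdorff => w w' ww'.
have [pp'|pp'] := eqVneq (tangent_proj w) (tangent_proj w').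
  pose i := chart_at (tangent_proj w).
  have iw : tangent_dom i w by exact: chart_at_dom.
  have iw' : tangent_dom i w' by rewrite /tangent_dom/= -pp'; exact: chart_at_dom.
  have : tangent_chart i w != tangent_chart i w'.
    apply: contra_neq ww' => ww'.
    by rewrite -(tangent_chartK iw) -(tangent_chartK iw') ww'.
  have : hausdorff_space 'rV[R]_(n + n) by exact: norm_hausdorff.
  rewrite open_hausdorff => H /H[[A B]/=].
  rewrite !inE => -[Aw Bw'] [oA oB AB].
  have oP C : open C -> open (tangent_dom i `&` tangent_chart i @^-1` C).
    move=> oC; rewrite openE => v [iv Cv]; apply: filterI.
      by apply: open_nbhs_nbhs; split => //; exact: tangent_dom_open.
    by apply: (tangent_chart_continuous iv); exact: open_nbhs_nbhs.
  exists (tangent_dom i `&` tangent_chart i @^-1` A,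
          tangent_dom i `&` tangent_chart i @^-1` B) => /=.
    by rewrite !inE.
  split; [exact: oP|exact: oP|].
  apply/eqP/seteqP; split => // v [[_ Av] [_ Bv]].
  have : (A `&` B) (tangent_chart i v) by split.
  by rewrite AB.
have := @mspace_hausdorff _ _ M.
rewrite open_hausdorff => /(_ _ _ pp')[[A B]/=].
rewrite !inE => -[Aw Bw'] [oA oB AB].
exists (tangent_proj @^-1` A, tangent_proj @^-1` B) => /=; first by rewrite !inE.
split; [exact: tangent_preimage_open|exact: tangent_preimage_open|].
apply/eqP/seteqP; split => // v [Av Bv].
have : (A `&` B) (tangent_proj v) by split.
by rewrite AB.
Qed.

Lemma tangent_second_countable : @second_countable TM.
Proof.
have [B cB [oB bB]] := @mspace_second_countable _ _ M.
have [Q cQ [oQ bQ]] := @second_countable_rV R (n + n).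
pose P (b : set M) (o : option (chart_index M)) :=
  if o is Some i then b `<=` chart_dom i else forall i, ~ b `<=` chart_dom i.
have HP b : exists o, P b o.
  have [[i bi]|H] := pselect (exists i, b `<=` chart_dom i); first by exists (Some i).
  by exists None => i bi; apply: H; exists i.
have [g gP] := choice HP.
pose S (bq : set M * set 'rV[R]_(n + n)) : set TM :=
  if g bq.1 is Some i
  then tangent_proj @^-1` bq.1 `&` (tangent_dom i `&` tangent_chart i @^-1` bq.2)
  else set0.
exists (S @` (B `*` Q)).
  by apply: sub_countable (card_image_le S _) _; exact: countableX.
split=> [_ [[b q] [/= Bb Qq] <-]|w A].
  rewrite /S/=; case: (g b) => [i|]; last exact: open0.
  apply: openI; first exact: tangent_preimage_open (oB _ Bb).
  rewrite openE => v [iv qv]; apply: filterI.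
    by apply: open_nbhs_nbhs; split => //; exact: tangent_dom_open.
  apply: (tangent_chart_continuous iv); apply: open_nbhs_nbhs; split => //.
  exact: oQ.
rewrite nbhsE => -[A' [oA' A'w] A'A].
pose c := chart_at (tangent_proj w).
have nc : nbhs (tangent_proj w) (chart_dom c).
  by apply: open_nbhs_nbhs; split; [exact: chart_dom_open|exact: chart_at_dom].
have [b [Bb bw] bc] := bB _ _ nc.
have := gP b; rewrite /P; case gb: (g b) => [i|]; last by move=> /(_ c).
move=> bi; have iw : tangent_dom i w by exact: bi.
have nV : nbhs (tangent_chart i w) (tangent_cod i `&` tangent_chart_inv i @^-1` A').
  apply: open_nbhs_nbhs; split; first exact: oA'.
  by split; [exact: tangent_chart_cod|rewrite /= tangent_chartK].
have [q [Qq qw] qV] := bQ _ _ nV.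
exists (S (b, q)); first by split; [exists (b, q)|rewrite /S/= gb].
rewrite /S/= gb => v [_ [iv qv]]; apply: A'A.
by have [_ /=] := qV _ qv; rewrite tangent_chartK.
Qed.

Definition tangent_bundle : manifold R (n + n) :=
  @Manifold R (n + n) TM tangent_hausdorff tangent_second_countable
    (chart_index M) tangent_dom tangent_cod tangent_chart tangent_chart_inv
    tangent_dom_open tangent_cod_open tangent_chart_cod tangent_chart_inv_dom
    tangent_chartK tangent_chart_invK tangent_chart_continuous
    tangent_chart_inv_continuous tangent_transition_smooth
    (fun w => chart_at (tangent_proj w)) (fun w => chart_at_dom (tangent_proj w)).

End TangentBundle.

(* Tensor fields are sections given pointwise: the value at p of a vector     *)
(* field (resp. bivector field) is the row (resp. matrix) of its components   *)
(* at p in the coordinates of chart_at p. Its components in another chart i   *)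
(* follow by the tensor transformation law, and smoothness is smoothness of   *)
(* these components in every chart.                                           *)
Section TensorFields.
Variables (R : realType) (n : nat) (M : manifold R n).
Implicit Types (f g h c : M -> R) (X : M -> 'rV[R]_n) (P : M -> 'M[R]_n).

Definition smooth_function f : Prop :=
  forall i, smooth_on (chart_range i) (f \o chart_inv i).

Definition vector_coord X (i : chart_index M) (x : 'rV[R]_n) : 'rV[R]_n :=
  let p := chart_inv i x in X p *m transition_jacobian (chart_at p) i p.

Definition vector_field X : Prop :=
  forall i, smooth_on (chart_range i) (vector_coord X i).

Definition bivector_coord P (i : chart_index M) (x : 'rV[R]_n) : 'M[R]_n :=
  let p := chart_inv i x in let J := transition_jacobian (chart_at p) i p in
  J^T *m P p *m J.

Definition bivector_field P : Prop :=
  (forall p, (P p)^T = - P p) /\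
  (forall i, smooth_on (chart_range i) (bivector_coord P i)).

(* The k-th component of df at p in the chart chart_at p.                     *)
Definition partial f (p : M) (k : 'I_n) : R :=
  'D_(basis_rV R k) (f \o chart_inv (chart_at p)) (chart (chart_at p) p).

(* {f, g} = P(df, dg).                                                        *)
Definition bracket P f g : M -> R := fun p =>
  \sum_(a < n) \sum_(b < n) P p a b * partial f p a * partial g p b.

Definition poisson_tensor P : Prop :=
  bivector_field P /\
  forall f g h, smooth_function f -> smooth_function g -> smooth_function h ->
  forall p, bracket P f (bracket P g h) p + bracket P g (bracket P h f) p +
            bracket P h (bracket P f g) p = 0.

Definition casimir P c : Prop :=
  smooth_function c /\
  forall f, smooth_function f -> forall p, bracket P f c p = 0.

(* Components at p, in the chart chart_at p, of the Lie derivative of P:      *)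
(* (L_X P)^ab = X^s d_s P^ab - P^sb d_s X^a - P^as d_s X^b.                   *)
Definition lie_derivative X P (p : M) : 'M[R]_n :=
  let i := chart_at p in let x := chart i p in
  \matrix_(a, b) \sum_(s < n)
    (X p 0 s * 'D_(basis_rV R s) (fun z => bivector_coord P i z a b) x
     - P p s b * 'D_(basis_rV R s) (fun z => vector_coord X i z 0 a) x
     - P p a s * 'D_(basis_rV R s) (fun z => vector_coord X i z 0 b) x).

Definition poisson_vector_field P X : Prop :=
  vector_field X /\ forall p, lie_derivative X P p = 0.

End TensorFields.

(* (u /\ v)(alpha, beta) = alpha(u) beta(v) - alpha(v) beta(u).               *)
Definition wedge (R : realType) (n : nat) (u v : 'rV[R]_n) : 'M[R]_n :=
  u^T *m v - v^T *m u.

Section TangentLifts.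
Variables (R : realType) (n : nat) (M : manifold R n).

(* The chart of TM around w is induced by chart_at (tangent_proj w); in its   *)
(* coordinates (x, y), components along d/dx come first, then along d/dy.     *)
Definition vertical_lift (X : M -> 'rV[R]_n) :
    tangent_bundle M -> 'rV[R]_(n + n) :=
  fun w => row_mx 0 (X (tangent_proj w)).

(* The bivector pi_TM at w, expressed in the coordinates (x, y) induced by    *)
(* the chart i of M. The bivector so described does not depend on i, and      *)
(* tangent_poisson reads it in the chart that represents tensors at w.        *)
Definition tangent_poisson_coord (P : M -> 'M[R]_n) (i : chart_index M)
    (w : tangent_bundle M) : 'M[R]_(n + n) :=
  let x := chart i (tangent_proj w) in
  let y := tangent_coord i w in
  let d_x a := basis_rV R (lshift n a) in
  let d_y a := basis_rV R (rshift n a) in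
  \sum_(a < n) \sum_(b < n) bivector_coord P i x a b *: wedge (d_x a) (d_y b)
  + 2^-1 *: \sum_(a < n) \sum_(b < n) \sum_(s < n)
      ('D_(basis_rV R s) (fun z => bivector_coord P i z a b) x * y 0 s)
        *: wedge (d_y a) (d_y b).

Definition tangent_poisson (P : M -> 'M[R]_n) :
    tangent_bundle M -> 'M[R]_(n + n) :=
  fun w => tangent_poisson_coord P (chart_at (tangent_proj w)) w.

End TangentLifts.

(* Main.v *)
Require Import Defs.
From HB Require Import structures.
From mathcomp Require Import all_boot all_order all_algebra.
From mathcomp Require Import all_classical all_reals all_analysis.
From mathcomp Require Import ring lra.
Import Order.TTheory GRing.Theory Num.Theory.
Import numFieldNormedType.Exports.
Local Open Scope classical_set_scope.
Local Open Scope ring_scope.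

Set Implicit Arguments.
Unset Strict Implicit.
Unset Printing Implicit Defensive.

(** The second part rests on a computation in induced coordinates (x,y) on TM. There
the bivector has the block form

   [ 0      pi          ]
   [ pi     D_y pi + B  ],     B = lambda c (X1 /\ X2 + X3 /\ X4),

with pi and B depending on x only ([tangent_poissonE], [tangent_deformation_coord]).
The Jacobi identity amounts to the vanishing of the cyclic sums
Q^(as) d_s Q^(bc) + Q^(bs) d_s Q^(ca) + Q^(cs) d_s Q^(ab). Sorting indices into
horizontal and vertical ones, these sums are ([jacobi_tangent_block])

 - zero when at most one index is vertical;
 - the same cyclic sum for pi, hence zero, when two are vertical;
 - the derivative along y of the cyclic sum for pi, plus the mixed sum of pi and B,
   when all three are vertical.

There is no term quadratic in B, since B points along the fibres and is constant on
them. The mixed sum represents the Schouten bracket [pi, B], and it vanishes because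
[pi, X /\ Y] = [pi,X] /\ Y - X /\ [pi,Y] = 0 for Poisson vector fields
([wedge_compatible]) and multiplication by a Casimir function introduces no further
term ([casimir_scale_compatible]).

Two passages connect this computation with the invariant statement. First, the Jacobi
identity and the Casimir condition are hypotheses on functions defined on the whole
manifold, while the computation needs identities between components in every chart.
By symmetry of second derivatives ([derive_basisC]) the Jacobiator involves only first
derivatives of the three functions ([local_jacobiator]), and cut-off coordinate functions,
built from exp(-1/t) and extended by zero, realise every coordinate differential at a
point ([exists_coordinate_function]); hence the identities [poisson_tensor_coord] and
[casimir_coord]. Conversely the components in one chart around each point control the
Jacobi identity ([jacobi_of_chart_at]). Secondly, tensors on TM are given pointwise in a
chart that varies with the point, so one must check that the block form is preserved by
induced chart changes. Their Jacobian is block triangular with the second derivatives of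
the transition map in its mixed block ([tangent_jacobianE]), exactly what differentiating
the transformation law of pi along y produces ([complete_lift_change]).

The first part is the second one for pi = 0, c = 1 and lambda = 1: every vector field is
Poisson for the zero tensor. *)

(** * Mixed partial derivatives and maps of class C^r *)

Section MixedPartials.
Variables (R : realType) (V : normedModType R).
Implicit Types (f fa fb fab fba : V -> R) (a b x y : V).

Lemma is_derive_along_line f y a (s df : R) :
  is_derive (y + s *: a) a f df ->
  is_derive s 1 (fun t : R => f (y + t *: a)) df.
Proof.
move=> [df1 df2].
have E : (fun h : R => h^-1 *: (((fun t : R => f (y + t *: a)) \o shift s) (h *: (1 : R))
      - f (y + s *: a))) =
    (fun h : R => h^-1 *: ((f \o shift (y + s *: a)) (h *: a) - f (y + s *: a))).
  apply/funext => h /=; congr (_ *: (f _ - _)).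
  by rewrite [h *: 1]mulr1 scalerDl addrCA.
apply: DeriveDef; first by rewrite /derivable E.
by rewrite -df2 /derive E.
Qed.

Lemma mvt_along_line f fa y a (h : R) : 0 < h ->
  (forall s : R, s \in `[0, h] -> is_derive (y + s *: a) a f (fa (y + s *: a))) ->
  exists2 s : R, s \in `[0, h] & f (y + h *: a) - f y = fa (y + s *: a) * h.
Proof.
move=> h0 H; pose g s := f (y + s *: a); pose dg s := fa (y + s *: a).
have Dg s : s \in `[0, h] -> is_derive s 1 g (dg s).
  by move=> si; apply: is_derive_along_line; exact: H.
have gc : {within `[0, h], continuous g}.
  apply: derivable_within_continuous => s si.
  exact: (@ex_derive _ _ _ _ _ _ _ (Dg s si)).
have Dgo (s : R) : s \in `]0, h[%R -> is_derive s 1 g (dg s).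
  by rewrite in_itv/= => /andP[s0 sh]; apply: Dg; rewrite in_itv/= !ltW.
have [s si] := MVT_segment (ltW h0) Dgo gc.
by rewrite [h - 0]subr0 /g /dg scale0r addr0 => E; exists s.
Qed.

(** The mean value theorem is used twice: on y |-> f (y + h b) - f y in the
direction a, then on fa in the direction b. The left-hand side is symmetric
in a and b, which is what makes mixed partial derivatives agree. The
derivatives are arguments rather than derive terms, so that nothing here
depends on how they are computed. *)
Lemma second_difference_mvt f fa fba x a b (h : R) : 0 < h ->
  (forall s t : R, s \in `[0, h] -> t \in `[0, h] ->
     let y := x + t *: b + s *: a in
     is_derive y a f (fa y) /\ is_derive y b fa (fba y)) ->
  exists s t : R, [/\ s \in `[0, h], t \in `[0, h] &
    f (x + h *: b + h *: a) - f (x + h *: b) - (f (x + h *: a) - f x) =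
    fba (x + t *: b + s *: a) * h ^+ 2].
Proof.
move=> h0 H.
have i0 : (0 : R) \in `[0, h] by rewrite in_itv/= lexx ltW.
have ih : h \in `[0, h] by rewrite in_itv/= lexx ltW.
have comm (u v : V) : x + u + v = x + v + u by rewrite addrAC.
pose g y := f (y + h *: b) - f y; pose ga y := fa (y + h *: b) - fa y.
have [s si Es] : exists2 s : R, s \in `[0, h] & g (x + h *: a) - g x = ga (x + s *: a) * h.
  apply: mvt_along_line => // s si; apply: is_deriveB; last first.
    by have [+ _] := H s 0 si i0; rewrite scale0r addr0.
  have [+ _] := H s h si ih; rewrite comm => -[d1 d2].
  have E : (fun r : R => r^-1 *: (((fun y => f (y + h *: b)) \o shift (x + s *: a)) (r *: a)
      - f (x + s *: a + h *: b))) =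
      (fun r : R => r^-1 *: ((f \o shift (x + s *: a + h *: b)) (r *: a)
      - f (x + s *: a + h *: b))).
    by apply/funext => r /=; congr (_ *: (f _ - _)); rewrite -addrA.
  by apply: DeriveDef; [rewrite /derivable E|rewrite -d2 /derive E].
have [t ti Et] : exists2 t : R, t \in `[0, h] &
    fa (x + s *: a + h *: b) - fa (x + s *: a) = fba (x + s *: a + t *: b) * h.
  apply: mvt_along_line => // t ti.
  by have [_] := H s t si ti; rewrite comm.
exists s, t; split => //; rewrite [X in fba X]comm expr2 mulrA -Et [RHS]/= -Es /g.
(* The two second differences group the same four values differently. *)
have swap (p q u v : R) : p - q - (u - v) = p - u - (q - v) by ring.
by rewrite swap [X in f X - _ - _]comm.
Qed.

(** The same second difference equals h^2 fba at one point and h^2 fab at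
another, both within distance O(h) of x; continuity at x concludes. *)
Lemma mixed_derivatives_eq f fa fb fab fba x a b :
  (\forall y \near x, [/\ is_derive y a f (fa y), is_derive y b f (fb y),
     is_derive y b fa (fba y) & is_derive y a fb (fab y)]) ->
  {for x, continuous fab} -> {for x, continuous fba} -> fab x = fba x.
Proof.
move=> H cab cba.
apply/eqP; rewrite -subr_eq0 -normr_le0; apply/ler_addgt0Pr => e e0; rewrite add0r.
have e2 : 0 < e / 2 by rewrite divr_gt0.
move/cvgrPdist_lt: cab => /(_ _ e2) nab; move/cvgrPdist_lt: cba => /(_ _ e2) nba.
have [d /= d0 Hd] := (nbhs_ballP x _).1 (filterI H (filterI nab nba)).
(* With this h the whole parallelogram x + [0,h] a + [0,h] b lies in the ball. *)
pose h := d / (2 * (`|a| + `|b| + 1)).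
have k0 : 0 < `|a| + `|b| + 1 by rewrite ltr_wpDl// addr_ge0.
have h0 : 0 < h by rewrite divr_gt0// mulr_gt0.
have Hb (s t : R) : s \in `[0, h] -> t \in `[0, h] -> ball x d (x + t *: b + s *: a).
  rewrite !in_itv/= => /andP[s0 sh] /andP[t0 th].
  rewrite -ball_normE /= -addrA opprD addNKr normrN.
  apply: le_lt_trans (ler_normD _ _) _; rewrite !normrZ !ger0_norm//.
  apply: (@le_lt_trans _ _ (h * (`|a| + `|b| + 1))).
    rewrite !mulrDr mulr1 [X in _ <= X + _]addrC; apply: ler_wpDr; first exact: ltW.
    by rewrite lerD// ler_wpM2r.
  have -> : h * (`|a| + `|b| + 1) = d / 2.
    by rewrite /h; field; rewrite gt_eqF.
  by rewrite ltr_pdivrMr// mulr_natr mulr2n ltrDl.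
have [s [t [si ti E]]] : exists s t : R, [/\ s \in `[0, h], t \in `[0, h] &
    f (x + h *: b + h *: a) - f (x + h *: b) - (f (x + h *: a) - f x) =
    fba (x + t *: b + s *: a) * h ^+ 2].
  apply: (@second_difference_mvt f fa) => // u v ui vi.
  by have [[? ? ? ?] _] := Hd _ (Hb u v ui vi).
have [t' [s' [ti' si' E']]] : exists t s : R, [/\ t \in `[0, h], s \in `[0, h] &
    f (x + h *: a + h *: b) - f (x + h *: a) - (f (x + h *: b) - f x) =
    fab (x + s *: a + t *: b) * h ^+ 2].
  apply: (@second_difference_mvt f fb) => // u v ui vi.
  by have [+ _] := Hd _ (Hb v u vi ui); rewrite addrAC => -[].
have {}E : fba (x + t *: b + s *: a) = fab (x + s' *: a + t' *: b).
  apply: (@mulIf _ (h ^+ 2)); first by rewrite expf_neq0// gt_eqF.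
  rewrite -E -E' [x + h *: a + h *: b]addrAC.
  have swap (p q u v : R) : p - q - (u - v) = p - u - (q - v) by ring.
  exact: swap.
have [_ [_ /= H1]] := Hd _ (Hb s t si ti).
have [_ [/= H2 _]] := Hd _ (Hb s' t' si' ti').
rewrite addrAC in H2; rewrite E in H1; move: H1 H2.
move: (fab x) (fba x) (fab _) => p q m H1 H2.
have -> : p - q = (p - m) - (q - m) by ring.
apply: le_trans (ler_normB _ _) _.
by rewrite [leRHS](splitr e) lerD// ltW.
Qed.

End MixedPartials.

Section SmoothFunctions.
Variables (R : realType) (n : nat).

Lemma derive_basisC (U : set 'rV[R]_n) (f : 'rV[R]_n -> R) (j k : 'I_n) x :
  open U -> Ck_on 2 U f -> U x ->
  'D_(basis_rV R j) ('D_(basis_rV R k) f) x = 'D_(basis_rV R k) ('D_(basis_rV R j) f) x.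
Proof.
move=> oU [df Df] Ux.
have [dj cj] := Df j; have [dk ck] := Df k.
apply: (@mixed_derivatives_eq _ _ f ('D_(basis_rV R j) f) ('D_(basis_rV R k) f)
  ('D_(basis_rV R j) ('D_(basis_rV R k) f)) ('D_(basis_rV R k) ('D_(basis_rV R j) f))
  x (basis_rV R j) (basis_rV R k)).
- apply: filterS (open_nbhs_nbhs (conj oU Ux)) => y Uy.
  split; apply: derivableP; apply: diff_derivable;
    [exact: df|exact: df|exact: dj|exact: dk].
- exact: ck.
- exact: cj.
Qed.



Lemma Ck_on_cover (V : normedModType R) r (U U1 U2 : set 'rV[R]_n) (f : 'rV[R]_n -> V) :
  U `<=` U1 `|` U2 -> Ck_on r U1 f -> Ck_on r U2 f -> Ck_on r U f.
Proof.
move=> UU; elim: r f => [|r IH] f /=.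
  by move=> c1 c2 x /UU[/c1|/c2].
by move=> [d1 D1] [d2 D2]; split=> [x /UU[/d1|/d2]//|k]; exact: IH.
Qed.

Lemma derive_comp (V : normedModType R) m (f : 'rV[R]_n -> V) (g : 'rV[R]_m -> 'rV[R]_n)
    x v : differentiable g x -> differentiable f (g x) ->
  'D_v (f \o g) x = \sum_(j < n) ('D_v g x) 0 j *: 'D_(basis_rV R j) f (g x).
Proof.
move=> dg df; have dfg : differentiable (f \o g) x by exact: differentiable_comp.
by rewrite deriveE// (diff_comp dg df)/= -(derive_basis _ df) (deriveE _ df) (deriveE _ dg).
Qed.

(** The chain rule expresses the first derivatives of the composite by those of
the two maps, one order of smoothness lower. *)
Lemma Ck_on_comp (V : normedModType R) m r (U : set 'rV[R]_m) (W : set 'rV[R]_n)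
    (f : 'rV[R]_n -> V) (g : 'rV[R]_m -> 'rV[R]_n) : open U ->
  (forall x, U x -> W (g x)) -> Ck_on r U g -> Ck_on r W f -> Ck_on r U (f \o g).
Proof.
move=> oU UW; elim: r f => [|r IH] f.
  by move=> cg cf x Ux; apply: continuous_comp; [exact: cg|exact/cf/UW].
move=> Cg Cf; have [dg Dg] := Cg; have [df Df] := Cf; split=> [x Ux|k].
  by apply: differentiable_comp; [exact: dg|exact/df/UW].
apply: (@Ck_on_ext _ _ _ _ _ (fun x =>
  \sum_(j < n) ('D_(basis_rV R k) g x) 0 j *: ('D_(basis_rV R j) f \o g) x)) => //.
  by move=> x Ux; rewrite derive_comp//; [exact: dg|exact/df/UW].
apply: Ck_on_sum => // j; apply: Ck_onZ => //.
  by apply: Ck_on_coord => //; exact: Dg.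
by apply: IH; [exact: Ck_onW|exact: Df].
Qed.

Lemma Ck_onM r (U : set 'rV[R]_n) (f g : 'rV[R]_n -> R) : open U ->
  Ck_on r U f -> Ck_on r U g -> Ck_on r U (fun x => f x * g x).
Proof. by move=> oU; exact: Ck_onZ. Qed.

Lemma Ck_onN (V : normedModType R) r (U : set 'rV[R]_n) (f : 'rV[R]_n -> V) : open U ->
  Ck_on r U f -> Ck_on r U (fun x => - f x).
Proof.
move=> oU Cf; under eq_fun do rewrite -scaleN1r.
by apply: Ck_onZ => //; exact: Ck_on_cst.
Qed.

Lemma entry_is_linear p q (a : 'I_p) (b : 'I_q) :
  linear (fun A : 'M[R]_(p, q) => A a b : R^o).
Proof. by move=> c A B; rewrite !mxE. Qed.

Lemma Ck_on_mxP p q r (U : set 'rV[R]_n) (f : 'rV[R]_n -> 'M[R]_(p, q)) : open U ->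
  Ck_on r U f <-> forall a b, Ck_on r U (fun x => f x a b).
Proof.
move=> oU; split=> [Cf a b|Cf].
  pose LM := GRing.isLinear.Build _ _ _ _ _ (entry_is_linear a b).
  pose L : {linear 'M[R]_(p, q) -> R} := HB.pack (fun A : 'M[R]_(p, q) => A a b : R) LM.
  by apply: (@Ck_on_linear _ _ _ _ _ _ L) => //; exact: coord_continuous.
have -> : f = (fun x => \sum_a \sum_b f x a b *: delta_mx a b).
  by apply/funext => x; rewrite -matrix_sum_delta.
apply: Ck_on_sum => // a; apply: Ck_on_sum => // b; apply: Ck_onZ => //.
exact: Ck_on_cst.
Qed.

Lemma smooth_onP (V : normedModType R) (U : set 'rV[R]_n) (f : 'rV[R]_n -> V) :
  smooth_on U f <-> (forall x, U x -> differentiable f x) /\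
    forall k, smooth_on U ('D_(basis_rV R k) f).
Proof.
split=> [Sf|[df Df] [|r]].
- by split=> [x Ux|k r]; [have [+ _] := Sf 1%N; exact|have [_] := Sf r.+1; exact].
- by move=> x Ux; apply: differentiable_continuous; exact: df.
- by split=> // k; exact: Df.
Qed.

Lemma smooth_on_differentiable (V : normedModType R) (U : set 'rV[R]_n)
  (f : 'rV[R]_n -> V) x : smooth_on U f -> U x -> differentiable f x.
Proof. by move=> /smooth_onP[+ _]; exact. Qed.

Lemma derivable_entry p q (F : 'rV[R]_n -> 'M[R]_(p, q)) x v i j :
  differentiable F x -> derivable (fun z => F z i j) x v.
Proof. by move=> dF; have /derivable_mxP := @diff_derivable _ _ _ F x v dF; exact. Qed.

Lemma derive_entry p q (f : 'rV[R]_n -> 'M[R]_(p, q)) x v a b :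
  derivable f x v -> ('D_v f x) a b = 'D_v (fun y => f y a b) x.
Proof. by move=> /derive_mx ->; rewrite mxE. Qed.

End SmoothFunctions.

(** * Coordinate functions cut off near a point *)

Section FlatFunction.
Variable R : realType.
Implicit Types (t : R) (k : nat).

(** For k = 0 this is the standard flat function exp(-1/t). The powers of 1/t make
the family closed under differentiation. *)
Definition flat k t : R := if 0 < t then t^-1 ^+ k * expR (- t^-1) else 0.

(** At t = 0 this turns the difference quotient of flat k into flat k.+1, so that
continuity of the whole family at 0 yields differentiability there. *)
Lemma flatS k t : flat k t = t * flat k.+1 t.
Proof.
rewrite /flat; case: ifPn => [t0|_]; last by rewrite mulr0.
by rewrite exprS !mulrA mulfV ?mul1r// gt_eqF.
Qed.

Lemma flat_le k t : `|flat k t| <= k.+1`!%:R * `|t|.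
Proof.
rewrite /flat; case: ifPn => [t0|_]; last by rewrite normr0 mulr_ge0.
have s0 : 0 < t^-1 by rewrite invr_gt0.
have f0 : 0 <= t^-1 ^+ k * expR (- t^-1).
  by rewrite mulr_ge0 ?expR_ge0// exprn_ge0// ltW.
rewrite (ger0_norm f0) gtr0_norm//.
rewrite expRN ler_pdivrMr ?expR_gt0//.
(* One term of the exponential series bounds the power of 1/t. *)
have H : t^-1 ^+ k.+1 <= k.+1`!%:R * expR t^-1.
  rewrite mulrC -ler_pdivrMr ?ltr0n ?fact_gt0//.
  by apply: le_trans (expR_ge1Dxn k (ltW s0)); rewrite lerDr.
have -> : t^-1 ^+ k = t * t^-1 ^+ k.+1 by rewrite exprS mulrA mulfV ?mul1r ?gt_eqF.
by rewrite mulrAC mulrC; apply: ler_wpM2r => //; exact: ltW.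
Qed.

Lemma flat_cvg0 k : flat k t @[t --> (0 : R)] --> (0 : R).
Proof.
apply/cvgrPdist_le => e e0; near=> t.
rewrite sub0r normrN (le_trans (flat_le k t))// mulrC -ler_pdivlMr ?ltr0n ?fact_gt0//.
near: t; apply/nbhs_normP; exists (e / k.+1`!%:R) => /=.
  by rewrite divr_gt0// ltr0n fact_gt0.
by move=> t /=; rewrite sub0r normrN => /ltW.
Unshelve. all: by end_near. Qed.

Lemma is_derive_flat k t :
  is_derive t 1 (flat k) (flat k.+2 t - k%:R * flat k.+1 t).
Proof.
have flat0 j : flat j 0 = 0 by rewrite /flat ltxx.
case: (ltrgtP t 0) => [t0|t0|->].
- have E : \near t, (cst 0 : R -> R) t = flat k t.
    near=> s; rewrite /flat ifF//; apply/negbTE; rewrite -leNgt.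
    by apply: ltW; near: s; exact: lt_nbhsl.
  have D := is_derive_cst (0 : R) t (1 : R).
  apply: is_derive_eq (near_eq_is_derive E D) _.
  by rewrite /flat ltNge ltW//= mulr0 subr0.
- have E : \near t, t^-1 ^+ k * expR (- t^-1) = flat k t.
    near=> s; rewrite /flat ifT//.
    by near: s; exact: lt_nbhsr.
  have tn0 : t != 0 by rewrite gt_eqF.
  have D1 : is_derive t 1 (fun t : R => t^-1) (- t ^- 2).
    apply: DeriveDef; first exact: (@derivableV _ _ id).
    by rewrite (@deriveV _ _ id)// derive_id [_ *: _]mulr1.
  have D2 : is_derive t 1 (fun t : R => expR (- t^-1)) (expR (- t^-1) * t^-2).
    have D0 : is_derive t 1 (fun t : R => - t^-1) (t ^- 2).
      by apply: is_derive_eq (is_deriveN D1) _; rewrite opprK.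
    exact: (@is_derive1_comp _ _ (fun t : R => - t^-1) _ _ _ (is_derive_expR (- t^-1)) D0).
  have DX : is_derive t 1 (fun t : R => t^-1 ^+ k) (- k%:R * t^-1 ^+ k.+1).
    case: k {E} => [|k].
      rewrite oppr0 mul0r; exact: is_derive_cst.
    have -> : (fun t : R => t^-1 ^+ k.+1) = (fun t : R => t^-1) ^+ k.+1.
      by apply/funext => s; rewrite fctE.
    apply: is_derive_eq.
    by rewrite /GRing.scale/= !exprS expr0; field.
  have D3 := is_deriveM DX D2.
  apply: is_derive_eq (near_eq_is_derive E D3) _.
  rewrite /flat t0 /= /GRing.scale/= !exprS expr0.
  by move: (expR _) => e; field.
- have E : (fun h : R => h^-1 *: ((flat k \o shift 0) (h *: (1 : R)) - flat k 0)) @ 0^'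
      --> (0 : R).
    have fc : flat k.+1 h @[h --> (0 : R)^'] --> (0 : R).
      exact: cvg_within_filter (flat_cvg0 k.+1).
    apply: cvg_trans fc; apply: near_eq_cvg; near=> h.
    rewrite /= addr0 flat0 subr0 [h *: 1]mulr1 [flat k h]flatS /GRing.scale/= mulKf//.
    by near: h; exact: nbhs_dnbhs_neq.
  apply: DeriveDef; first by apply/cvg_ex; exists 0.
  by rewrite !flat0 mulr0 subr0; apply/cvg_lim.
Unshelve. all: by end_near. Qed.

End FlatFunction.

Section Bump.
Variables (R : realType) (n : nat).

(** Induction on the order, for all k at once, since differentiating flat k brings
in flat k.+1 and flat k.+2. *)
Lemma Ck_on_flat r k (U : set 'rV[R]_n) (u : 'rV[R]_n -> R) : open U ->
  smooth_on U u -> Ck_on r U (fun x => flat k (u x)).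
Proof.
move=> oU Su; elim: r k => [|r IH] k.
  move=> x Ux; apply: (@continuous_comp _ _ _ u (flat k)); first exact: (Su 0%N).
  apply/differentiable_continuous/derivable1_diffP.
  exact: (@ex_derive _ _ _ _ _ _ _ (is_derive_flat k (u x))).
have [du Du] := (smooth_onP U u).1 Su.
have df t : differentiable (@flat R k) t.
  by apply/derivable1_diffP; exact: (@ex_derive _ _ _ _ _ _ _ (is_derive_flat k t)).
split=> [x Ux|j].
  by apply: (@differentiable_comp _ _ _ _ u (flat k)) => //; exact: du.
apply: (@Ck_on_ext _ _ _ _ _ (fun x => 'D_(basis_rV R j) u x
    * (flat k.+2 (u x) + - (k%:R * flat k.+1 (u x))))) => //.
  move=> x Ux; have dfu : differentiable (flat k \o u) x.
    by apply: differentiable_comp => //; exact: du.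
  rewrite (deriveE _ (du x Ux)) (deriveE (f := flat k \o u) _ dfu).
  rewrite (diff_comp (du x Ux) (df _))/=.
  rewrite diff1E// /GRing.scale/= derive1E.
  by rewrite (@derive_val _ _ _ _ _ _ _ (is_derive_flat k (u x))).
apply: Ck_onM => //; first exact: Du.
by apply: Ck_onD => //; apply: Ck_onN => //; apply: Ck_onM => //; exact: Ck_on_cst.
Qed.

Lemma smooth_on_coord (U : set 'rV[R]_n) (b : 'I_n) : open U ->
  smooth_on U (fun x : 'rV[R]_n => x 0 b).
Proof. by move=> oU r; apply: Ck_on_coord => //; exact: Ck_on_id. Qed.

Lemma derive_coord (a b : 'I_n) (x : 'rV[R]_n) :
  'D_(basis_rV R b) (fun x : 'rV[R]_n => x 0 a) x = (a == b)%:R.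
Proof.
by rewrite -(@derive_entry _ _ _ _ id) ?derive_id ?mxE.
Qed.

(** The product of x_a - x0_a with a bump function psi centred at x0 has differential
psi(x0) dx_a at x0, because its first factor vanishes there; dividing by psi(x0) gives
dx_a. *)
Lemma local_coordinate (U : set 'rV[R]_n) (x0 : 'rV[R]_n) (a : 'I_n) : open U -> U x0 ->
  exists (K : set 'rV[R]_n) (phi : 'rV[R]_n -> R),
    [/\ compact K, K `<=` U, smooth_on U phi, forall x, ~ K x -> phi x = 0 &
     forall b, 'D_(basis_rV R b) phi x0 = (a == b)%:R].
Proof.
move=> oU Ux0.
have /nbhs_closedballP[d dU] : nbhs x0 U by exact: open_nbhs_nbhs.
(* The norm is the maximum norm, so the Euclidean ball u > 0 lies inside the ball
   of radius d. *)
pose u (x : 'rV[R]_n) : R := d%:num ^+ 2 + - \sum_(k < n) (x 0 k + - x0 0 k) * (x 0 k + - x0 0 k).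
pose psi x := flat 0 (u x).
pose l (x : 'rV[R]_n) : R := (psi x0)^-1 * (x 0 a + - x0 0 a).
have Sc k : smooth_on U (fun x : 'rV[R]_n => x 0 k + - x0 0 k).
  by move=> r; apply: Ck_onD => //; [exact: smooth_on_coord|exact: Ck_on_cst].
have Su : smooth_on U u.
  move=> r; apply: Ck_onD => //; first exact: Ck_on_cst.
  apply: Ck_onN => //; apply: Ck_on_sum => // k; apply: Ck_onM => //; exact: Sc.
have Spsi : smooth_on U psi by move=> r; exact: Ck_on_flat.
have Sl : smooth_on U l by move=> r; apply: Ck_onM => //; [exact: Ck_on_cst|exact: Sc].
have psi0 : psi x0 != 0.
  rewrite /psi /u big1 ?oppr0 ?addr0; last by move=> k _; rewrite subrr mul0r.
  by rewrite /flat exprn_gt0// expr0 mul1r gt_eqF// expR_gt0.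
exists (closed_ball x0 d%:num), (fun x => l x * psi x); split => //.
- apply: bounded_closed_compact; last exact: closed_ball_closed.
  exists (`|x0| + d%:num); split; first exact: num_real.
  move=> N HN y; rewrite closed_ballE// /closed_ball_/= => xy.
  apply: le_trans (ltW HN); rewrite -{1}[y](subrK x0) addrC.
  by apply: le_trans (ler_normD _ _) _; rewrite lerD2l distrC.
- by move=> r; exact: Ck_onM.
- move=> x Kx; rewrite /psi /flat; case: ifPn; rewrite ?mulr0// => ux.
  exfalso; apply: Kx; apply: subset_closed_ball; split => // i k; rewrite ord1.
  rewrite /ball/= distrC -ltr_sqr ?nnegrE// real_normK ?num_real//.
  move: ux; rewrite /u subr_gt0 (bigD1 k)//= -expr2; apply: le_lt_trans.
  by rewrite lerDl; apply: sumr_ge0 => j _; rewrite -expr2 sqr_ge0.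
move=> b; rewrite deriveM; first last.
- by apply: diff_derivable; exact: smooth_on_differentiable Spsi _.
- by apply: diff_derivable; exact: smooth_on_differentiable Sl _.
have -> : l x0 = 0 by rewrite /l subrr mulr0.
rewrite scale0r add0r deriveMl; last first.
  by apply: diff_derivable; exact: smooth_on_differentiable (Sc a) _.
rewrite deriveD; first last.
- exact: derivable_cst.
- by apply: diff_derivable; exact: smooth_on_differentiable (smooth_on_coord a oU) _.
by rewrite derive_coord derive_cst addr0 /GRing.scale/= mulrA divff// mul1r.
Qed.
End Bump.

(** * The Jacobiator of a bivector on an open set *)

Section NestedBracketAlgebra.
Variables (R : comPzRingType) (n : nat).
Implicit Types (u v w : 'I_n -> R) (p H : 'I_n -> 'I_n -> R).

Definition hessian_form H v w : R := \sum_s \sum_t v s * w t * H s t.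

Lemma hessian_formC H v w : (forall s t, H s t = H t s) -> hessian_form H v w = hessian_form H w v.
Proof.
move=> HC; rewrite /hessian_form exchange_big; apply: eq_bigr => s _; apply: eq_bigr => t _.
by rewrite HC (mulrC (v t)).
Qed.

(** Up to sign, the components of the Hamiltonian vector field of a function with
differential u. *)
Definition hamiltonian p u s : R := \sum_a p a s * u a.

(** The value of {f,{g,h}} when p, dp are the bivector and its first derivatives, u, v, w
the differentials of f, g, h, and V, W the Hessians of g and h. Antisymmetry of p
puts the second-order part into Hessian form, where cyclic summation cancels it. *)
Lemma nested_bracket_expand p (dp : 'I_n -> 'I_n -> 'I_n -> R) u v w (V W : 'I_n -> 'I_n -> R) :
  (forall a b, p a b = - p b a) ->
  \sum_a \sum_s p a s * u a * (\sum_b \sum_c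
     (dp s b c * v b * w c + p b c * V s b * w c + p b c * v b * W s c)) =
  \sum_a \sum_b \sum_c (\sum_s p a s * dp s b c) * (u a * v b * w c)
  - hessian_form V (hamiltonian p u) (hamiltonian p w)
  + hessian_form W (hamiltonian p u) (hamiltonian p v).
Proof.
move=> pN.
transitivity (\sum_s hamiltonian p u s * (\sum_b \sum_c dp s b c * v b * w c)
   + \sum_s hamiltonian p u s * (\sum_b V s b * (\sum_c p b c * w c))
   + \sum_s hamiltonian p u s * (\sum_c W s c * (\sum_b p b c * v b))).
  rewrite exchange_big -!big_split; apply: eq_bigr => s _ /=.
  rewrite -mulr_suml -!mulrDr; congr (_ * _).
  transitivity (\sum_b \sum_c dp s b c * v b * w c + \sum_b \sum_c p b c * V s b * w c
     + \sum_b \sum_c p b c * v b * W s c).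
    by rewrite -!big_split; apply: eq_bigr => b _; rewrite -!big_split.
  congr (_ + _ + _).
    apply: eq_bigr => b _; rewrite mulr_sumr; apply: eq_bigr => c _; ring.
  rewrite exchange_big; apply: eq_bigr => c _; rewrite mulr_sumr.
  by apply: eq_bigr => b _; ring.
congr (_ + _ + _).
- under eq_bigr => s _.
    rewrite mulr_suml; under eq_bigr => a _.
      rewrite mulr_sumr; under eq_bigr => b _ do rewrite mulr_sumr.
      over.
    over.
  rewrite exchange_big; apply: eq_bigr => a _.
  rewrite exchange_big; apply: eq_bigr => b _.
  rewrite exchange_big; apply: eq_bigr => c _.
  by rewrite mulr_suml; apply: eq_bigr => s _; ring.
- rewrite /hessian_form -sumrN; apply: eq_bigr => s _.
  rewrite mulr_sumr -sumrN; apply: eq_bigr => b _.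
  have -> : \sum_c p b c * w c = - hamiltonian p w b.
    by rewrite /hamiltonian -sumrN; apply: eq_bigr => c _; rewrite (pN b c) mulNr.
  ring.
- rewrite /hessian_form; apply: eq_bigr => s _; rewrite mulr_sumr; apply: eq_bigr => c _.
  by rewrite -/(hamiltonian p v c); ring.
Qed.

Lemma sum3_rotate (I : finType) (T : I -> I -> I -> R) :
  \sum_a \sum_b \sum_c T b c a = \sum_a \sum_b \sum_c T a b c.
Proof. by rewrite exchange_big; apply: eq_bigr => b _; rewrite exchange_big. Qed.

End NestedBracketAlgebra.

Section LocalPoisson.
Variables (R : realType) (n : nat).
Local Notation E := 'rV[R]_n.
Local Notation d k f := ('D_(basis_rV R k) f).
Implicit Types (A B : E -> 'M[R]_n) (f g h : E -> R) (x : E).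

Lemma derive_fsum m (F : 'I_m -> E -> R) (x v : E) :
  (forall i, derivable (F i) x v) ->
  'D_v (fun y => \sum_i F i y) x = \sum_i 'D_v (F i) x.
Proof.
move=> dF; rewrite -derive_sum//; congr ('D_v _ x).
by apply/funext => y; rewrite fct_sumE.
Qed.

Lemma derivable_fsum m (F : 'I_m -> E -> R) (x v : E) :
  (forall i, derivable (F i) x v) -> derivable (fun y => \sum_i F i y) x v.
Proof.
move=> dF; have := derivable_sum dF; congr (derivable _ x v).
by apply/funext => y; rewrite fct_sumE.
Qed.

Lemma is_derive_prod3 f g h (x v : E) (df dg dh : R) :
  is_derive x v f df -> is_derive x v g dg -> is_derive x v h dh ->
  is_derive x v (fun y => f y * g y * h y)
    (df * g x * h x + f x * dg * h x + f x * g x * dh).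
Proof.
move=> Df Dg Dh; apply: is_derive_eq (is_deriveM (is_deriveM Df Dg) Dh) _.
by rewrite !fctE /GRing.scale/=; ring.
Qed.

Definition local_bracket A f g x : R :=
  \sum_a \sum_b A x a b * d a f x * d b g x.

Definition schouten_term A B x a b c : R :=
  \sum_s A x a s * d s (fun z => B z b c) x.

(** For antisymmetric A and B and up to a constant factor, the Schouten bracket [A,B] has
components cyclic_schouten A B + cyclic_schouten B A. Keeping the two halves apart
lets one expression serve for [A,A] as well. *)
Definition cyclic_schouten A B x a b c : R :=
  schouten_term A B x a b c + schouten_term A B x b c a + schouten_term A B x c a b.

Lemma smooth_derive (U : set E) f k : smooth_on U f -> smooth_on U (d k f).
Proof. by move=> /smooth_onP[_]. Qed.

Lemma smooth_derivable (V : normedModType R) (U : set E) (f : E -> V) x v :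
  smooth_on U f -> U x -> derivable f x v.
Proof. by move=> sf Ux; apply: diff_derivable; exact: smooth_on_differentiable Ux. Qed.

Lemma smooth_entry (U : set E) A a b : open U -> smooth_on U A ->
  smooth_on U (fun x => A x a b).
Proof. by move=> oU SA r; have /(Ck_on_mxP _ _ oU) := SA r; apply. Qed.

Lemma smooth_local_bracket (U : set E) A f g : open U ->
  smooth_on U A -> smooth_on U f -> smooth_on U g -> smooth_on U (local_bracket A f g).
Proof.
move=> oU SA Sf Sg r; apply: Ck_on_sum => // a; apply: Ck_on_sum => // b.
apply: Ck_onM => //; last exact: smooth_derive.
by apply: Ck_onM => //; [exact: smooth_entry|exact: smooth_derive].
Qed.

Lemma nested_local_bracket (U : set E) A f g h x : open U -> U x ->
  smooth_on U A -> (A x)^T = - A x ->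
  smooth_on U f -> smooth_on U g -> smooth_on U h ->
  let X (u : E -> R) := hamiltonian (A x) (fun a => d a u x) in
  let H (u : E -> R) := hessian_form (fun s t => d s (d t u) x) in
  local_bracket A f (local_bracket A g h) x =
  \sum_a \sum_b \sum_c schouten_term A A x a b c * (d a f x * d b g x * d c h x)
  - H g (X f) (X h) + H h (X f) (X g).
Proof.
move=> oU Ux SA AN Sf Sg Sh X H.
rewrite -nested_bracket_expand; last first.
  by move=> a b; have /matrixP/(_ b a) := AN; rewrite !mxE.
apply: eq_bigr => a _; apply: eq_bigr => s _; congr (_ * _).
have D b c : is_derive x (basis_rV R s) (fun y => A y b c * d b g y * d c h y)
    (d s (fun z => A z b c) x * d b g x * d c h x + A x b c * d s (d b g) x * d c h x
     + A x b c * d b g x * d s (d c h) x).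
  apply: is_derive_prod3; apply: derivableP; apply: (smooth_derivable (U := U)) => //.
  - exact: smooth_entry.
  - exact: smooth_derive.
  - exact: smooth_derive.
rewrite derive_fsum; last first.
  move=> b; apply: derivable_fsum => c; exact: (@ex_derive _ _ _ _ _ _ _ (D b c)).
apply: eq_bigr => b _; rewrite derive_fsum; last first.
  move=> c; exact: (@ex_derive _ _ _ _ _ _ _ (D b c)).
by apply: eq_bigr => c _; rewrite (@derive_val _ _ _ _ _ _ _ (D b c)).
Qed.

(** Each Hessian occurs twice in the cyclic sum, with opposite signs and with its two
arguments exchanged, so only the terms with a derivative of A remain. Hence the
Jacobiator depends on f, g, h through their first derivatives alone. *)
Lemma local_jacobiator (U : set E) A f g h x : open U -> U x ->
  smooth_on U A -> (A x)^T = - A x ->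
  smooth_on U f -> smooth_on U g -> smooth_on U h ->
  local_bracket A f (local_bracket A g h) x + local_bracket A g (local_bracket A h f) x
    + local_bracket A h (local_bracket A f g) x =
  \sum_a \sum_b \sum_c cyclic_schouten A A x a b c * (d a f x * d b g x * d c h x).
Proof.
move=> oU Ux SA AN Sf Sg Sh.
pose X (u : E -> R) := hamiltonian (A x) (fun a => d a u x).
pose H (u : E -> R) := hessian_form (fun s t => d s (d t u) x).
pose S (u v w : E -> R) := \sum_a \sum_b \sum_c
  schouten_term A A x a b c * (d a u x * d b v x * d c w x).
have nested u v w : smooth_on U u -> smooth_on U v -> smooth_on U w ->
    local_bracket A u (local_bracket A v w) x =
    S u v w - H v (X u) (X w) + H w (X u) (X v).
  by move=> Su Sv Sw; exact: (nested_local_bracket oU Ux).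
have HC (u : E -> R) v w : smooth_on U u -> H u v w = H u w v.
  by move=> Su; apply: hessian_formC => s t; apply: (derive_basisC (U := U)).
have SE : \sum_a \sum_b \sum_c cyclic_schouten A A x a b c * (d a f x * d b g x * d c h x)
    = S f g h + S g h f + S h f g.
  rewrite /S -[in X in _ + X + _]sum3_rotate.
  rewrite -[in X in _ + _ + X]sum3_rotate -[in X in _ + _ + X]sum3_rotate.
  rewrite -!big_split /=; apply: eq_bigr => a _.
  rewrite -!big_split /=; apply: eq_bigr => b _.
  rewrite -!big_split /=; apply: eq_bigr => c _.
  rewrite /cyclic_schouten.
  move: (d a f x) (d b g x) (d c h x) => u v w.
  by rewrite !mulrDl; congr (_ * _ + _ * _ + _ * _); ring.
rewrite SE !nested// (HC f)// (HC g)// (HC h)//.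
move: (S f g h) (S g h f) (S h f g) (H f _ _) (H g _ _) (H h _ _) => *; ring.
Qed.

End LocalPoisson.

(** * Brackets in charts *)

Section Charts.
Variables (R : realType) (n : nat) (M : manifold R n).
Local Notation E := 'rV[R]_n.
Local Notation d k f := ('D_(basis_rV R k) f).
Local Notation J := transition_jacobian.
Implicit Types (i j : chart_index M) (p : M) (P : M -> 'M[R]_n) (f g h : M -> R).

Lemma mem_transition_domain i j p : chart_dom i p -> chart_dom j p ->
  (chart_range i `&` chart_inv i @^-1` chart_dom j) (chart i p).
Proof. by move=> ip jp; split; [exact: chart_in_range|rewrite /= chartK]. Qed.

Lemma transition_jacobianE i j p a b : chart_dom i p -> chart_dom j p ->
  J i j p a b = d a (fun z => chart j (chart_inv i z) 0 b) (chart i p).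
Proof.
move=> ip jp.
have dt := transition_differentiable (mem_transition_domain ip jp).
have := deriveEjacobian (basis_rV R a) dt.
rewrite /basis_rV -rowE => /rowP/(_ b); rewrite mxE => <-.
by rewrite (@derive_entry _ _ _ _ (chart j \o chart_inv i))//; exact: diff_derivable.
Qed.

(** A column, so that it transforms by left multiplication with the Jacobian while
vector fields, being rows, transform by right multiplication. *)
Definition dcoord f i (x : E) : 'cV[R]_n := \col_k d k (f \o chart_inv i) x.

Lemma dcoord_change f i j p : smooth_function f -> chart_dom i p -> chart_dom j p ->
  dcoord f i (chart i p) = J i j p *m dcoord f j (chart j p).
Proof.
move=> Sf ip jp; apply/colP => k; rewrite [LHS]mxE [RHS]mxE.
have Ut := mem_transition_domain ip jp.
have dt := transition_differentiable Ut.
have df : differentiable (f \o chart_inv j) ((chart j \o chart_inv i) (chart i p)).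
  apply: smooth_on_differentiable (Sf j) _; rewrite /= chartK//; exact: chart_in_range.
have -> : d k (f \o chart_inv i) (chart i p) =
    d k ((f \o chart_inv j) \o (chart j \o chart_inv i)) (chart i p).
  apply: near_eq_derive.
  have := open_nbhs_nbhs (conj (open_chart_inv_preimage (@chart_dom_open _ _ M j)) Ut).
  apply: filterS.
  by move=> z [_ /= jz]; rewrite chartK.
rewrite derive_comp//; apply: eq_bigr => a _; rewrite transition_jacobianE// [in RHS]mxE.
rewrite derive_entry; last exact: diff_derivable.
by rewrite /= chartK.
Qed.

Lemma local_bracket_dcoord (A : E -> 'M[R]_n) f g i x :
  local_bracket A (f \o chart_inv i) (g \o chart_inv i) x =
  ((dcoord f i x)^T *m A x *m dcoord g i x) 0 0.
Proof.
rewrite /local_bracket [RHS]mxE exchange_big; apply: eq_bigr => b _.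
rewrite [in RHS]mxE [dcoord g i x b 0]mxE mulr_suml; apply: eq_bigr => a _.
by rewrite [in RHS]mxE [dcoord f i x a 0]mxE (mulrC (A x a b)).
Qed.

Lemma bivector_coord_chart P i p : chart_dom i p ->
  bivector_coord P i (chart i p) = (J (chart_at p) i p)^T *m P p *m J (chart_at p) i p.
Proof. by move=> ip; rewrite /bivector_coord chartK. Qed.

Lemma bivector_coord_at P p : bivector_coord P (chart_at p) (chart (chart_at p) p) = P p.
Proof.
have cp := chart_at_dom p.
by rewrite bivector_coord_chart// transition_jacobian_id// trmx1 mul1mx mulmx1.
Qed.

(** The bracket at p is defined through the chart selected at p, which varies with p;
iterated brackets can be differentiated only once they are written in one fixed
chart near p. *)
Lemma bracket_chart P f g i p : smooth_function f -> smooth_function g ->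
  chart_dom i p ->
  bracket P f g p =
  local_bracket (bivector_coord P i) (f \o chart_inv i) (g \o chart_inv i) (chart i p).
Proof.
move=> Sf Sg ip; have cp := chart_at_dom p.
have bracket_at : bracket P f g p = ((dcoord f (chart_at p) (chart (chart_at p) p))^T *m
    P p *m dcoord g (chart_at p) (chart (chart_at p) p)) 0 0.
  by rewrite -bivector_coord_at -local_bracket_dcoord /local_bracket bivector_coord_at.
apply: etrans bracket_at (etrans _ (esym (local_bracket_dcoord _ _ _ _ _))).
rewrite bivector_coord_chart// (dcoord_change Sf cp ip) (dcoord_change Sg cp ip).
by rewrite trmx_mul !mulmxA.
Qed.

Lemma bracket_chart_inv P f g i x : smooth_function f -> smooth_function g ->
  chart_range i x ->
  (bracket P f g \o chart_inv i) x =
  local_bracket (bivector_coord P i) (f \o chart_inv i) (g \o chart_inv i) x.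
Proof.
move=> Sf Sg cx; rewrite /= -{2}(chart_invK cx).
exact: (bracket_chart P Sf Sg (chart_inv_dom cx)).
Qed.

Lemma smooth_bracket P f g : bivector_field P -> smooth_function f -> smooth_function g ->
  smooth_function (bracket P f g).
Proof.
move=> [_ SP] Sf Sg i r; have oi := @chart_range_open _ _ M i.
apply: (Ck_on_ext oi) => [x cx|]; first by rewrite bracket_chart_inv.
exact: (smooth_local_bracket oi (SP i) (Sf i) (Sg i)).
Qed.

Lemma bivector_coord_antisym P i x : bivector_field P ->
  (bivector_coord P i x)^T = - bivector_coord P i x.
Proof.
move=> [PN _]; rewrite /bivector_coord !trmx_mul trmxK PN mulNmx mulmxN.
by rewrite mulmxA.
Qed.

Lemma eq_local_bracket (A : E -> 'M[R]_n) (f g g' : E -> R) x :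
  (\near x, g x = g' x) -> local_bracket A f g x = local_bracket A f g' x.
Proof.
move=> gg'; apply: eq_bigr => a _; apply: eq_bigr => b _.
by rewrite (near_eq_derive _ gg').
Qed.

Lemma nested_bracket_chart P f g h i p : bivector_field P ->
  smooth_function f -> smooth_function g -> smooth_function h -> chart_dom i p ->
  let A := bivector_coord P i in
  bracket P f (bracket P g h) p =
  local_bracket A (f \o chart_inv i)
    (local_bracket A (g \o chart_inv i) (h \o chart_inv i)) (chart i p).
Proof.
move=> PP Sf Sg Sh ip A; apply: etrans (bracket_chart P Sf (smooth_bracket PP Sg Sh) ip) _.
apply: eq_local_bracket.
have := open_nbhs_nbhs (conj (@chart_range_open _ _ M i) (chart_in_range ip)).
by apply: filterS => x cx; exact: bracket_chart_inv.
Qed.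

Lemma jacobiator_chart P f g h i p : bivector_field P ->
  smooth_function f -> smooth_function g -> smooth_function h -> chart_dom i p ->
  let A := bivector_coord P i in let x := chart i p in
  bracket P f (bracket P g h) p + bracket P g (bracket P h f) p +
    bracket P h (bracket P f g) p =
  \sum_a \sum_b \sum_c cyclic_schouten A A x a b c *
    (d a (f \o chart_inv i) x * d b (g \o chart_inv i) x * d c (h \o chart_inv i) x).
Proof.
move=> PP Sf Sg Sh ip A x.
apply: etrans (local_jacobiator (@chart_range_open _ _ M i) (chart_in_range ip) (PP.2 i)
  (bivector_coord_antisym i x PP) (Sf i) (Sg i) (Sh i)).
exact: (f_equal2 +%R (f_equal2 +%R (nested_bracket_chart PP Sf Sg Sh ip)
  (nested_bracket_chart PP Sg Sh Sf ip)) (nested_bracket_chart PP Sh Sf Sg ip)).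
Qed.

(** It suffices to know the components of the Schouten bracket at each point in one chart
around that point. *)
Lemma jacobi_of_chart_at P : bivector_field P ->
  (forall p a b c, let A := bivector_coord P (chart_at p) in
     cyclic_schouten A A (chart (chart_at p) p) a b c = 0) ->
  poisson_tensor P.
Proof.
move=> PP H; split=> // f g h Sf Sg Sh p.
rewrite (jacobiator_chart PP Sf Sg Sh (chart_at_dom p)).
by do 3 (rewrite big1// => ? _); rewrite H mul0r.
Qed.

(** The image of the compact set K is closed because the manifold is Hausdorff. So the
extension by zero is smooth: in any chart, the domain of chart i and the complement
of that image form an open cover. *)
Lemma smooth_function_extension i (K : set E) (phi : E -> R) :
  compact K -> K `<=` chart_range i -> smooth_on (chart_range i) phi ->
  (forall x, ~ K x -> phi x = 0) ->
  exists2 f, smooth_function f & forall x, chart_range i x -> f (chart_inv i x) = phi x.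
Proof.
move=> cK Ki Sphi phi0.
pose f p := if pselect (chart_dom i p) then phi (chart i p) else 0.
exists f; last first.
  move=> x cx; rewrite /f; case: pselect => [ix|]; first by rewrite chart_invK.
  by have := chart_inv_dom cx.
have clK : closed (chart_inv i @` K).
  apply: compact_closed; first exact: mspace_hausdorff.
  apply: continuous_compact => //.
  apply: continuous_in_subspaceT => x; rewrite inE => /Ki; exact: chart_inv_continuous.
move=> j r.
pose U1 := chart_range j `&` chart_inv j @^-1` chart_dom i.
pose U2 := chart_range j `&` chart_inv j @^-1` (~` (chart_inv i @` K)).
have oU1 : open U1 by apply: open_chart_inv_preimage; exact: chart_dom_open.
have oU2 : open U2 by apply: open_chart_inv_preimage; exact: closed_openC.
apply: (@Ck_on_cover _ _ _ _ _ U1 U2).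
- move=> x cx; have [Kx|nKx] := pselect ((chart_inv i @` K) (chart_inv j x)).
    by left; split=> //; case: Kx => z /Ki cz /= <-; exact: chart_inv_dom.
  by right.
- apply: (@Ck_on_ext _ _ _ _ _ (phi \o (chart i \o chart_inv j))) => //.
    by move=> x [_ /= ix]; rewrite /f; case: pselect.
  apply: (Ck_on_comp (W := chart_range i)) => //.
  + by move=> x [_ ix]; exact: chart_in_range.
  + exact: transition_smooth.
- apply: (@Ck_on_ext _ _ _ _ _ (fun=> 0)) => //; last exact: Ck_on_cst.
  move=> x [_ /= nK]; rewrite /f; case: pselect => // ix; rewrite phi0// => Kx.
  by apply: nK; exists (chart i (chart_inv j x)) => //; rewrite chartK.
Qed.

(** Hypotheses on brackets concern functions defined on all of M; these functions have any
prescribed coordinate differential at a point, and so turn such hypotheses into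
identities between components. *)
Lemma exists_coordinate_function i x a : chart_range i x ->
  exists2 f, smooth_function f & forall b, d b (f \o chart_inv i) x = (a == b)%:R.
Proof.
move=> cx.
have [K [phi [cK Ki Sphi phi0 Dphi]]] := local_coordinate a (@chart_range_open _ _ M i) cx.
have [f Sf Ef] := smooth_function_extension cK Ki Sphi phi0.
exists f => // b; rewrite -Dphi; apply: near_eq_derive.
by apply: filterS (open_nbhs_nbhs (conj (@chart_range_open _ _ M i) cx)).
Qed.

Lemma sum_pick (F : 'I_n -> R) a : \sum_b F b * (a == b)%:R = F a.
Proof.
rewrite (bigD1 a)//= eqxx mulr1 big1 ?addr0// => b /negbTE ba.
by rewrite eq_sym ba mulr0.
Qed.

Lemma poisson_tensor_coord P i x a b c : poisson_tensor P -> chart_range i x ->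
  let A := bivector_coord P i in cyclic_schouten A A x a b c = 0.
Proof.
move=> [PP HJ] cx A.
have [f Sf Df] := exists_coordinate_function a cx.
have [g Sg Dg] := exists_coordinate_function b cx.
have [h Sh Dh] := exists_coordinate_function c cx.
have := HJ f g h Sf Sg Sh (chart_inv i x).
rewrite (jacobiator_chart PP Sf Sg Sh (chart_inv_dom cx)) chart_invK// => H.
rewrite -[RHS]H.
transitivity (\sum_a' \sum_b' \sum_c' cyclic_schouten A A x a' b' c' * (c == c')%:R
   * (b == b')%:R * (a == a')%:R).
  rewrite -(sum_pick (fun a' => cyclic_schouten A A x a' b c)); apply: eq_bigr => a' _.
  rewrite -(sum_pick (fun b' => cyclic_schouten A A x a' b' c)) mulr_suml.
  apply: eq_bigr => b' _.
  by rewrite -(sum_pick (fun c' => cyclic_schouten A A x a' b' c')) !mulr_suml.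
apply: eq_bigr => a' _; apply: eq_bigr => b' _; apply: eq_bigr => c' _.
by rewrite Df Dg Dh; ring.
Qed.

Lemma casimir_coord P f i x a : casimir P f -> chart_range i x ->
  \sum_b bivector_coord P i x a b * d b (f \o chart_inv i) x = 0.
Proof.
move=> [Sf Cf] cx.
have [g Sg Dg] := exists_coordinate_function a cx.
have := Cf g Sg (chart_inv i x).
rewrite (bracket_chart P Sg Sf (chart_inv_dom cx)) chart_invK// => H; rewrite -[RHS]H.
rewrite -[LHS](sum_pick (fun a => \sum_b bivector_coord P i x a b * d b (f \o chart_inv i) x)).
apply: eq_bigr => a' _; rewrite mulr_suml; apply: eq_bigr => b _.
by rewrite Dg mulrAC.
Qed.

End Charts.

(** * Deforming a block bivector along the fibres *)

Section VerticalDeformation.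
Variables (R : realType) (n : nat).
Local Notation E := 'rV[R]_n.
Local Notation d k f := ('D_(basis_rV R k) f).
Implicit Types (A B W : E -> 'M[R]_n) (X Y : E -> E) (f : E -> R) (x : E).

(** The derivative of X^b along the a-th row of A. The Lie derivative of A along X is
X(A)^(ab) - A^(as) d_s X^b + A^(bs) d_s X^a. *)
Definition anchor_derivative A X x a b : R := \sum_s A x a s * d s (fun z => X z 0 b) x.

Definition lie_derivative_vanishes_at A X x :=
  forall a b, \sum_s X x 0 s * d s (fun z => A z a b) x =
    anchor_derivative A X x a b - anchor_derivative A X x b a.

Lemma schouten_term_wedge A X Y x a b c : 
  differentiable X x -> differentiable Y x ->
  schouten_term A (fun z => wedge (X z) (Y z)) x a b c =
  anchor_derivative A X x a b * Y x 0 c + X x 0 b * anchor_derivative A Y x a c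
  - anchor_derivative A X x a c * Y x 0 b - X x 0 c * anchor_derivative A Y x a b.
Proof.
move=> dX dY.
have D s (V : E -> E) k : differentiable V x ->
    is_derive x (basis_rV R s) (fun z => V z 0 k) (d s (fun z => V z 0 k) x).
  by move=> dV; apply: derivableP; exact: derivable_entry.
rewrite /schouten_term /anchor_derivative !mulr_suml !mulr_sumr -!sumrN -!big_split /=.
apply: eq_bigr => s _.
have -> : (fun z => wedge (X z) (Y z) b c) =
    (fun z => X z 0 b * Y z 0 c - Y z 0 b * X z 0 c).
  by apply/funext => z; rewrite /wedge !mxE !big_ord1 !mxE.
have H := is_deriveB (is_deriveM (D s X b dX) (D s Y c dY)) (is_deriveM (D s Y b dY) (D s X c dX)).
rewrite (@derive_val _ _ _ _ _ _ _ H) /GRing.scale/=.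
move: (d s _ x) (d s _ x) (d s _ x) (d s _ x) => *; ring.
Qed.

Lemma wedge_schouten_term A X Y x a b c :
  lie_derivative_vanishes_at A X x -> lie_derivative_vanishes_at A Y x ->
  schouten_term (fun z => wedge (X z) (Y z)) A x a b c =
  X x 0 a * (anchor_derivative A Y x b c - anchor_derivative A Y x c b)
  - Y x 0 a * (anchor_derivative A X x b c - anchor_derivative A X x c b).
Proof.
move=> /(_ b c) <- /(_ b c) <-; rewrite /schouten_term !mulr_sumr -sumrN -big_split /=.
apply: eq_bigr => s _; rewrite /wedge !mxE !big_ord1 !mxE.
by move: (d s _ x) => *; ring.
Qed.

(** This is [A, X /\ Y] = [A,X] /\ Y - X /\ [A,Y] = 0 in components. Write u and v for the
anchor derivatives of X and Y. The first cyclic sum consists of terms X^b v^(ac) and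
u^(ab) Y^c, and the vanishing Lie derivatives turn the second one into its opposite. *)
Lemma wedge_compatible A X Y x a b c :
  differentiable X x -> differentiable Y x ->
  lie_derivative_vanishes_at A X x -> lie_derivative_vanishes_at A Y x ->
  let W z := wedge (X z) (Y z) in
  cyclic_schouten A W x a b c + cyclic_schouten W A x a b c = 0.
Proof.
move=> dX dY pX pY W; rewrite /cyclic_schouten.
rewrite !(schouten_term_wedge _ _ _ _ dX dY) !(wedge_schouten_term _ _ _ pX pY).
move: (anchor_derivative A X x) (anchor_derivative A Y x) => u v; ring.
Qed.


(** [A, f W] = f [A,W] + [A,f] /\ W, and [A,f] vanishes for a Casimir function f. *)
Lemma casimir_scale_compatible A f W x a b c :
  differentiable f x -> differentiable W x ->
  (forall a, \sum_s A x a s * d s f x = 0) ->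
  cyclic_schouten A W x a b c + cyclic_schouten W A x a b c = 0 ->
  cyclic_schouten A (fun z => f z *: W z) x a b c
    + cyclic_schouten (fun z => f z *: W z) A x a b c = 0.
Proof.
move=> df dW Af H.
have E1 i j k : schouten_term A (fun z => f z *: W z) x i j k = f x * schouten_term A W x i j k.
  transitivity (f x * schouten_term A W x i j k + W x j k * (\sum_s A x i s * d s f x)); last first.
    by rewrite Af mulr0 addr0.
  rewrite /schouten_term !mulr_sumr -big_split /=; apply: eq_bigr => s _.
  have -> : (fun z => (f z *: W z) j k) = (fun z => f z * W z j k).
    by apply/funext => z; rewrite mxE.
  have DW : derivable (fun z => W z j k) x (basis_rV R s).
    exact: derivable_entry.
  have D := is_deriveM (derivableP (@diff_derivable _ _ _ f x (basis_rV R s) df)) (derivableP DW).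
  rewrite (@derive_val _ _ _ _ _ _ _ D) /GRing.scale/=.
  by move: (d s _ x) (d s _ x) => *; ring.
have E2 i j k : schouten_term (fun z => f z *: W z) A x i j k = f x * schouten_term W A x i j k.
  by rewrite /schouten_term mulr_sumr; apply: eq_bigr => s _; rewrite mxE mulrA.
rewrite /cyclic_schouten !E1 !E2 -!mulrDr; move: H; rewrite /cyclic_schouten => ->.
by rewrite mulr0.
Qed.

Lemma schouten_compatibleD A W W' x a b c :
  differentiable W x -> differentiable W' x ->
  cyclic_schouten A W x a b c + cyclic_schouten W A x a b c = 0 ->
  cyclic_schouten A W' x a b c + cyclic_schouten W' A x a b c = 0 ->
  cyclic_schouten A (fun z => W z + W' z) x a b c
    + cyclic_schouten (fun z => W z + W' z) A x a b c = 0.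
Proof.
move=> dW dW' H H'.
have E1 i j k : schouten_term A (fun z => W z + W' z) x i j k =
    schouten_term A W x i j k + schouten_term A W' x i j k.
  rewrite /schouten_term -big_split /=; apply: eq_bigr => s _.
  have -> : (fun z => (W z + W' z) j k) = (fun z => W z j k + W' z j k).
    by apply/funext => z; rewrite mxE.
  have DW V : differentiable V x -> derivable (fun z => (V z : 'M[R]_n) j k) x (basis_rV R s).
    exact: derivable_entry.
  by rewrite deriveD ?mulrDr//; exact: DW.
have E2 i j k : schouten_term (fun z => W z + W' z) A x i j k =
    schouten_term W A x i j k + schouten_term W' A x i j k.
  by rewrite /schouten_term -big_split; apply: eq_bigr => s _; rewrite mxE mulrDl.
have := f_equal2 +%R H H'; rewrite addr0 => S; rewrite -[RHS]S.
rewrite /cyclic_schouten !E1 !E2.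
move: (schouten_term A W x) (schouten_term A W' x) (schouten_term W A x) (schouten_term W' A x).
by move=> s t u v; ring.
Qed.

End VerticalDeformation.

Section TangentBlock.
Variables (R : realType) (n : nat).
Local Notation E := 'rV[R]_n.
Local Notation TE := 'rV[R]_(n + n).
Local Notation d k f := ('D_(basis_rV R k) f).
Implicit Types (A B : E -> 'M[R]_n) (f g : E -> R) (x : E) (z : TE) (k : 'I_n).

(** The function y^s d_s f on the tangent space in coordinates z = (x,y), that is df
regarded as a function linear along the fibres. Its derivatives in the fibre
directions are again the partial derivatives of f, and those in the base
directions are complete lifts of partial derivatives up to exchanging two
derivatives. *)
Definition complete_lift f z : R := \sum_s rsubmx z 0 s * d s f (lsubmx z).

Lemma pullback_quotient f z (v : TE) :
  (fun h : R => h^-1 *: (((fun z => f (lsubmx z)) \o shift z) (h *: v) - f (lsubmx z))) =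
  (fun h : R => h^-1 *: ((f \o shift (lsubmx z)) (h *: lsubmx v) - f (lsubmx z))).
Proof. by apply/funext => h /=; rewrite linearP. Qed.

Lemma derive_pullback f z (v : TE) :
  'D_v (fun z => f (lsubmx z)) z = 'D_(lsubmx v) f (lsubmx z).
Proof. by rewrite /derive pullback_quotient. Qed.

Lemma derivable_pullback f z (v : TE) :
  derivable f (lsubmx z) (lsubmx v) -> derivable (fun z => f (lsubmx z)) z v.
Proof. by rewrite /derivable pullback_quotient. Qed.

Lemma lsubmx_basis_l k : lsubmx (basis_rV R (lshift n k)) = basis_rV R k.
Proof. by apply/rowP => j; rewrite !mxE !eqxx eq_lshift. Qed.

Lemma lsubmx_basis_r k : lsubmx (basis_rV R (rshift n k)) = 0.
Proof. by apply/rowP => j; rewrite !mxE eq_lrshift andbF. Qed.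

Lemma rsubmx_basis_l k : rsubmx (basis_rV R (lshift n k)) = 0.
Proof. by apply/rowP => j; rewrite !mxE eq_rlshift andbF. Qed.

Lemma rsubmx_basis_r k : rsubmx (basis_rV R (rshift n k)) = basis_rV R k.
Proof. by apply/rowP => j; rewrite !mxE !eqxx eq_rshift. Qed.

Lemma complete_liftE f z : differentiable f (lsubmx z) ->
  complete_lift f z = 'D_(rsubmx z) f (lsubmx z).
Proof. by move=> df; rewrite (derive_basis _ df). Qed.

Lemma is_derive_complete_lift (U : set E) f z (v : TE) :
  smooth_on U f -> U (lsubmx z) ->
  is_derive z v (complete_lift f)
    (\sum_s (rsubmx v 0 s * d s f (lsubmx z)
             + rsubmx z 0 s * 'D_(lsubmx v) (d s f) (lsubmx z))).
Proof.
move=> Sf Uz.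
have D s : is_derive z v (fun z => rsubmx z 0 s * d s f (lsubmx z))
   (rsubmx v 0 s * d s f (lsubmx z) + rsubmx z 0 s * 'D_(lsubmx v) (d s f) (lsubmx z)).
  have D1 : is_derive z v (fun z => rsubmx z 0 s) (rsubmx v 0 s).
    have -> : (fun z : TE => rsubmx z 0 s) = (fun z => z 0 (rshift n s)).
      by apply/funext => y; rewrite mxE.
    apply: DeriveDef; first by apply: derivable_entry; exact: ex_diff.
    by rewrite -(@derive_entry _ _ _ _ id) ?derive_id ?mxE.
  have D2 : is_derive z v (fun z => d s f (lsubmx z)) ('D_(lsubmx v) (d s f) (lsubmx z)).
    apply: DeriveDef; last exact: (derive_pullback (d s f)).
    apply: (derivable_pullback (f := d s f)).
    exact: smooth_derivable (smooth_derive s Sf) Uz.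
  apply: is_derive_eq (is_deriveM D1 D2) _.
  by rewrite /GRing.scale/= addrC; congr (_ + _); rewrite mulrC.
apply: DeriveDef; first by apply: derivable_fsum => s; exact: (@ex_derive _ _ _ _ _ _ _ (D s)).
rewrite derive_fsum; last by move=> s; exact: (@ex_derive _ _ _ _ _ _ _ (D s)).
by apply: eq_bigr => s _; rewrite (@derive_val _ _ _ _ _ _ _ (D s)).
Qed.

Lemma derive_complete_lift_l (U : set E) f z k : smooth_on U f -> U (lsubmx z) ->
  d (lshift n k) (complete_lift f) z = \sum_s rsubmx z 0 s * d k (d s f) (lsubmx z).
Proof.
move=> Sf Uz; apply: etrans (@derive_val _ _ _ _ _ _ _ (is_derive_complete_lift _ Sf Uz)) _.
by apply: eq_bigr => s _; rewrite lsubmx_basis_l rsubmx_basis_l mxE mul0r add0r.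
Qed.

Lemma derive_complete_lift_r (U : set E) f z k : smooth_on U f -> U (lsubmx z) ->
  d (rshift n k) (complete_lift f) z = d k f (lsubmx z).
Proof.
move=> Sf Uz; apply: etrans (@derive_val _ _ _ _ _ _ _ (is_derive_complete_lift _ Sf Uz)) _.
rewrite lsubmx_basis_r rsubmx_basis_r (bigD1 k)//= big1 => [|s sk].
  by rewrite addr0 mxE !eqxx mul1r derive0 mulr0 addr0.
by rewrite mxE (negbTE sk) mul0r add0r derive0 mulr0.
Qed.

(** In induced coordinates (x,y), the tangent lift of A plus the vertical lift of B.
Deformations of the tangent Poisson tensor by vertical bivectors keep this shape. *)
Definition tangent_block A B z : 'M[R]_(n + n) :=
  let x := lsubmx z in
  block_mx 0 (A x) (A x) (\matrix_(a, b) complete_lift (fun x => A x a b) z + B x).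

Lemma derive_pullback_l f z k :
  d (lshift n k) (fun z => f (lsubmx z)) z = d k f (lsubmx z).
Proof. by apply: etrans (derive_pullback f z _) _; rewrite lsubmx_basis_l. Qed.

Lemma derive_pullback_r f z k :
  d (rshift n k) (fun z => f (lsubmx z)) z = 0.
Proof.
by apply: etrans (derive_pullback f z _) _; rewrite lsubmx_basis_r derive0.
Qed.



Section TangentBlockSchouten.
Variables (U : set E) (A B : E -> 'M[R]_n) (z : TE).
Hypotheses (oU : open U) (SA : smooth_on U A) (SB : smooth_on U B) (Uz : U (lsubmx z)).
Let x := lsubmx z.
Let Q := tangent_block A B.
Implicit Types (b c s : 'I_n).

Lemma tangent_block_ll (a b : 'I_n) y : Q y (lshift n a) (lshift n b) = 0.
Proof. by rewrite /Q /tangent_block block_mxEul mxE. Qed.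

Lemma tangent_block_lr (a b : 'I_n) y : Q y (lshift n a) (rshift n b) = A (lsubmx y) a b.
Proof. by rewrite /Q /tangent_block block_mxEur. Qed.

Lemma tangent_block_rl (a b : 'I_n) y : Q y (rshift n a) (lshift n b) = A (lsubmx y) a b.
Proof. by rewrite /Q /tangent_block block_mxEdl. Qed.

Lemma tangent_block_rr (a b : 'I_n) y : Q y (rshift n a) (rshift n b) =
  complete_lift (fun x => A x a b) y + B (lsubmx y) a b.
Proof. by rewrite /Q /tangent_block block_mxEdr mxE mxE. Qed.

Let SAe b c : smooth_on U (fun x => A x b c). Proof. exact: smooth_entry. Qed.
Let SBe b c : smooth_on U (fun x => B x b c). Proof. exact: smooth_entry. Qed.

Lemma derive_tangent_block_ll (k : 'I_(n + n)) b c :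
  d k (fun y => Q y (lshift n b) (lshift n c)) z = 0.
Proof. by rewrite (funext (tangent_block_ll b c)); exact: derive_cst. Qed.

Lemma derive_tangent_block_lr_l k b c :
  d (lshift n k) (fun y => Q y (lshift n b) (rshift n c)) z = d k (fun x => A x b c) x.
Proof.
rewrite (funext (tangent_block_lr b c)).
exact: (derive_pullback_l (fun x => A x b c)).
Qed.

Lemma derive_tangent_block_lr_r k b c :
  d (rshift n k) (fun y => Q y (lshift n b) (rshift n c)) z = 0.
Proof.
rewrite (funext (tangent_block_lr b c)).
exact: (derive_pullback_r (fun x => A x b c)).
Qed.

Lemma derive_tangent_block_rl_l k b c :
  d (lshift n k) (fun y => Q y (rshift n b) (lshift n c)) z = d k (fun x => A x b c) x.
Proof.
rewrite (funext (tangent_block_rl b c)).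
exact: (derive_pullback_l (fun x => A x b c)).
Qed.

Lemma derive_tangent_block_rl_r k b c :
  d (rshift n k) (fun y => Q y (rshift n b) (lshift n c)) z = 0.
Proof.
rewrite (funext (tangent_block_rl b c)).
exact: (derive_pullback_r (fun x => A x b c)).
Qed.

Lemma derive_tangent_block_rr (v : TE) b c :
  'D_v (fun y => Q y (rshift n b) (rshift n c)) z =
  'D_v (complete_lift (fun x => A x b c)) z + 'D_v (fun y => B (lsubmx y) b c) z.
Proof.
rewrite (funext (tangent_block_rr b c)).
apply: (@deriveD _ _ _ (complete_lift (fun x => A x b c)) (fun y => B (lsubmx y) b c)).
  exact: (@ex_derive _ _ _ _ _ _ _ (is_derive_complete_lift v (SAe b c) Uz)).
apply: (derivable_pullback (f := fun x => B x b c)).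
exact: smooth_derivable (SBe b c) Uz.
Qed.

Lemma derive_tangent_block_rr_l k b c :
  d (lshift n k) (fun y => Q y (rshift n b) (rshift n c)) z =
  \sum_s rsubmx z 0 s * d k (d s (fun x => A x b c)) x + d k (fun x => B x b c) x.
Proof.
apply: etrans (derive_tangent_block_rr _ b c) _; congr (_ + _).
  exact: derive_complete_lift_l (SAe b c) Uz.
exact: (derive_pullback_l (fun x => B x b c)).
Qed.

Lemma derive_tangent_block_rr_r k b c :
  d (rshift n k) (fun y => Q y (rshift n b) (rshift n c)) z = d k (fun x => A x b c) x.
Proof.
apply: etrans (derive_tangent_block_rr _ b c) _; rewrite -[RHS]addr0; congr (_ + _).
  exact: derive_complete_lift_r (SAe b c) Uz.
exact: (derive_pullback_r (fun x => B x b c)).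
Qed.

Lemma sum_split_ord (p q : 'I_(n + n) -> R) (pl pr ql qr : 'I_n -> R) :
  (forall s, p (lshift n s) = pl s) -> (forall s, p (rshift n s) = pr s) ->
  (forall s, q (lshift n s) = ql s) -> (forall s, q (rshift n s) = qr s) ->
  \sum_s p s * q s = \sum_s pl s * ql s + \sum_s pr s * qr s.
Proof.
move=> pL pR qL qR; rewrite big_split_ord.
by congr (_ + _); apply: eq_bigr => s _; rewrite ?pL ?pR ?qL ?qR.
Qed.

Lemma sum_mul0 (q : 'I_n -> R) : \sum_s 0 * q s = 0.
Proof. by rewrite big1 // => s _; rewrite mul0r. Qed.

Lemma sum_mulr0 (q : 'I_n -> R) : \sum_s q s * 0 = 0.
Proof. by rewrite big1 // => s _; rewrite mulr0. Qed.

(** The terms are sorted by how many of the three indices are vertical. With at most one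
vertical index, every product has a factor that is an entry of the zero block, its
derivative, or a vertical derivative of a function of x. With exactly two, only the
corresponding term for A on the base survives. *)
Lemma schouten_lll a b c : schouten_term Q Q z (lshift n a) (lshift n b) (lshift n c) = 0.
Proof.
apply: etrans (sum_split_ord (fun s => tangent_block_ll a s z) (fun s => tangent_block_lr a s z)
  (fun s => derive_tangent_block_ll (lshift n s) b c)
  (fun s => derive_tangent_block_ll (rshift n s) b c)) _.
by rewrite sum_mul0 sum_mulr0 addr0.
Qed.

Lemma schouten_llr a b c : schouten_term Q Q z (lshift n a) (lshift n b) (rshift n c) = 0.
Proof.
apply: etrans (sum_split_ord (fun s => tangent_block_ll a s z) (fun s => tangent_block_lr a s z)
  (fun s => derive_tangent_block_lr_l s b c)
  (fun s => derive_tangent_block_lr_r s b c)) _.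
by rewrite sum_mul0 sum_mulr0 addr0.
Qed.

Lemma schouten_lrl a b c : schouten_term Q Q z (lshift n a) (rshift n b) (lshift n c) = 0.
Proof.
apply: etrans (sum_split_ord (fun s => tangent_block_ll a s z) (fun s => tangent_block_lr a s z)
  (fun s => derive_tangent_block_rl_l s b c)
  (fun s => derive_tangent_block_rl_r s b c)) _.
by rewrite sum_mul0 sum_mulr0 addr0.
Qed.

Lemma schouten_rll a b c : schouten_term Q Q z (rshift n a) (lshift n b) (lshift n c) = 0.
Proof.
apply: etrans (sum_split_ord (fun s => tangent_block_rl a s z) (fun s => tangent_block_rr a s z)
  (fun s => derive_tangent_block_ll (lshift n s) b c)
  (fun s => derive_tangent_block_ll (rshift n s) b c)) _.
by rewrite !sum_mulr0 addr0.
Qed.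

Lemma schouten_lrr a b c : schouten_term Q Q z (lshift n a) (rshift n b) (rshift n c) = 
  schouten_term A A x a b c.
Proof.
apply: etrans (sum_split_ord (fun s => tangent_block_ll a s z) (fun s => tangent_block_lr a s z)
  (fun s => derive_tangent_block_rr_l s b c)
  (fun s => derive_tangent_block_rr_r s b c)) _.
by rewrite sum_mul0 add0r.
Qed.

Lemma schouten_rlr a b c : schouten_term Q Q z (rshift n a) (lshift n b) (rshift n c) = 
  schouten_term A A x a b c.
Proof.
apply: etrans (sum_split_ord (fun s => tangent_block_rl a s z) (fun s => tangent_block_rr a s z)
  (fun s => derive_tangent_block_lr_l s b c)
  (fun s => derive_tangent_block_lr_r s b c)) _.
by rewrite sum_mulr0 addr0.
Qed.

Lemma schouten_rrl a b c : schouten_term Q Q z (rshift n a) (rshift n b) (lshift n c) = 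
  schouten_term A A x a b c.
Proof.
apply: etrans (sum_split_ord (fun s => tangent_block_rl a s z) (fun s => tangent_block_rr a s z)
  (fun s => derive_tangent_block_rl_l s b c)
  (fun s => derive_tangent_block_rl_r s b c)) _.
by rewrite sum_mulr0 addr0.
Qed.

Lemma smooth_schouten_term a b c :
  smooth_on U (fun x => schouten_term A A x a b c).
Proof.
move=> r; apply: Ck_on_sum => // s; apply: Ck_onM => //; first exact: SAe.
exact: smooth_derive (SAe b c) r.
Qed.

(** With three vertical indices, the terms in A alone are the derivative along y of the
sum of the A^(as) d_s A^(bc). No product of B with a derivative of B occurs, because B
depends on x only. *)
Lemma schouten_rrr a b c : schouten_term Q Q z (rshift n a) (rshift n b) (rshift n c) =
  complete_lift (fun x => schouten_term A A x a b c) z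
  + schouten_term A B x a b c + schouten_term B A x a b c.
Proof.
have lift_st : complete_lift (fun x => schouten_term A A x a b c) z =
    \sum_s A x a s * (\sum_t rsubmx z 0 t * d s (d t (fun x => A x b c)) x)
    + \sum_s complete_lift (fun x => A x a s) z * d s (fun x => A x b c) x.
  rewrite -big_split /=.
  under [RHS]eq_bigr do rewrite mulr_sumr mulr_suml -big_split /=.
  rewrite exchange_big; apply: eq_bigr => t _ /=.
  have D s : is_derive x (basis_rV R t) (fun y => A y a s * d s (fun x => A x b c) y)
     (A x a s * d t (d s (fun x => A x b c)) x + d s (fun x => A x b c) x
      * d t (fun x => A x a s) x).
    apply: is_deriveM; apply: derivableP; first exact: smooth_derivable (SAe a s) Uz.
    exact: smooth_derivable (smooth_derive s (SAe b c)) Uz.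
  rewrite derive_fsum; last by move=> s; exact: (@ex_derive _ _ _ _ _ _ _ (D s)).
  rewrite mulr_sumr; apply: eq_bigr => s _.
  rewrite (@derive_val _ _ _ _ _ _ _ (D s)).
  rewrite (derive_basisC s t oU (SAe b c 2%N) Uz).
  by move: (d t _ x) (d s _ x) (d t _ x) => *; ring.
rewrite lift_st; apply: etrans (sum_split_ord (fun s => tangent_block_rl a s z)
  (fun s => tangent_block_rr a s z)
  (fun s => derive_tangent_block_rr_l s b c)
  (fun s => derive_tangent_block_rr_r s b c)) _.
under eq_bigr do rewrite mulrDr.
under [X in _ + X = _]eq_bigr do rewrite mulrDl.
rewrite !big_split /= /schouten_term -/x.
move: (\sum_s _) (\sum_s _) (\sum_s _) (\sum_s _) => *; ring.
Qed.

End TangentBlockSchouten.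

(** A quadratic term in B would need a derivative of B in a vertical direction, so it is
absent: it suffices that [A,A] = 0 near the base point and [A,B] = 0 at it. The
complete lift of [A,A], which appears in the vertical components, vanishes because
[A,A] vanishes on an open set. *)
Lemma jacobi_tangent_block (U : set E) A B z a b c : open U ->
  smooth_on U A -> smooth_on U B -> U (lsubmx z) ->
  (forall x a b c, U x -> cyclic_schouten A A x a b c = 0) ->
  (forall a b c, let x := lsubmx z in
     cyclic_schouten A B x a b c + cyclic_schouten B A x a b c = 0) ->
  let Q := tangent_block A B in cyclic_schouten Q Q z a b c = 0.
Proof.
move=> oU SA SB Uz AA AB Q.
have lll := schouten_lll A B z; have llr := schouten_llr A B z.
have lrl := schouten_lrl A B z; have rll := schouten_rll A B z.
have lrr := schouten_lrr oU SA SB Uz; have rlr := schouten_rlr A B z.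
have rrl := schouten_rrl A B z; have rrr := schouten_rrr oU SA SB Uz.
have cyc := AA _ _ _ _ Uz.
rewrite /cyclic_schouten in cyc *.
case: (split_ordP a) => {}a ->; case: (split_ordP b) => {}b ->;
  case: (split_ordP c) => {}c ->;
  rewrite ?lll ?llr ?lrl ?rll ?lrr ?rlr ?rrl ?addr0//.
rewrite !rrr.
have lift0 : complete_lift (fun x => schouten_term A A x a b c) z +
    complete_lift (fun x => schouten_term A A x b c a) z +
    complete_lift (fun x => schouten_term A A x c a b) z = 0.
  rewrite -!big_split big1//= => t _; rewrite -!mulrDr.
  have D i j k : is_derive (lsubmx z) (basis_rV R t) (fun x => schouten_term A A x i j k)
      (d t (fun x => schouten_term A A x i j k) (lsubmx z)).
    by apply: derivableP; exact: smooth_derivable (smooth_schouten_term oU SA i j k) Uz.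
  have DD := is_deriveD (is_deriveD (D a b c) (D b c a)) (D c a b).
  rewrite -(@derive_val _ _ _ _ _ _ _ DD).
  rewrite (near_eq_derive (g := cst 0)) ?derive_cst ?mulr0//.
  by apply: filterS (open_nbhs_nbhs (conj oU Uz)) => y Uy; exact: AA.
have := f_equal2 +%R lift0 (AB a b c); rewrite addr0 => H; rewrite -[RHS]H.
rewrite /cyclic_schouten.
move: (complete_lift _ _) (complete_lift _ _) (complete_lift _ _).
move: (schouten_term A B _) (schouten_term B A _) => *; ring.
Qed.

End TangentBlock.

(** * Change of charts on the tangent bundle *)

Section TangentCharts.
Variables (R : realType) (n : nat) (M : manifold R n).
Local Notation E := 'rV[R]_n.
Local Notation TE := 'rV[R]_(n + n).
Local Notation TM := (tangent_bundle M).
Local Notation d k f := ('D_(basis_rV R k) f).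
Local Notation J := transition_jacobian.
Implicit Types (i j : chart_index M) (p : M) (w : TM) (P B : M -> 'M[R]_n) (z : TE).

Lemma bivector_coord_change P i j p : chart_dom i p -> chart_dom j p ->
  bivector_coord P j (chart j p) =
  (J i j p)^T *m bivector_coord P i (chart i p) *m J i j p.
Proof.
move=> ip jp; apply: etrans (bivector_coord_chart P jp) _.
rewrite (bivector_coord_chart P ip) (transition_jacobian_comp (chart_at_dom p) ip jp).
by rewrite trmx_mul !mulmxA.
Qed.

Definition transition_coord i j (b : 'I_n) (x : E) : R := chart j (chart_inv i x) 0 b.

Definition transition_domain i j : set E := chart_range i `&` chart_inv i @^-1` chart_dom j.

Lemma transition_domain_open i j : open (transition_domain i j).
Proof. exact: open_chart_inv_preimage (@chart_dom_open _ _ M j). Qed.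

Lemma smooth_transition_coord i j b :
  smooth_on (transition_domain i j) (transition_coord i j b).
Proof.
move=> r; apply: (Ck_on_coord (f := chart j \o chart_inv i)).
  exact: transition_domain_open.
exact: transition_smooth.
Qed.

(** The mixed block of the Jacobian of an induced chart change (x,y) |-> (tau x, D_y tau x). *)
Definition transition_hessian i j p (y : E) : 'M[R]_n :=
  \matrix_(a, b) \sum_s y 0 s * d a (d s (transition_coord i j b)) (chart i p).

Lemma tangent_jacobianE i j w :
  chart_dom i (tangent_proj w) -> chart_dom j (tangent_proj w) ->
  let p := tangent_proj w in
  transition_jacobian (M := TM) i j w =
  block_mx (J i j p) (transition_hessian i j p (tangent_coord i w)) 0 (J i j p).
Proof.
move=> iw jw p.
pose z : TE := tangent_chart i w.
have lz : lsubmx z = chart i p by exact: row_mxKl.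
have rz : rsubmx z = tangent_coord i w by exact: row_mxKr.
have Uz : transition_domain i j (lsubmx z) by rewrite lz; exact: mem_transition_domain.
have JE a b : J i j p a b = d a (transition_coord i j b) (lsubmx z).
  by rewrite lz; exact: transition_jacobianE.
have TJ (a b : 'I_(n + n)) : transition_jacobian (M := TM) i j w a b =
    d a (fun z => tangent_chart j (tangent_chart_inv i z) 0 b) z.
  exact: (@transition_jacobianE _ _ TM i j w a b iw jw).
have chl (b : 'I_n) : (fun z : TE => tangent_chart j (tangent_chart_inv i z) 0 (lshift n b)) =
    (fun z => transition_coord i j b (lsubmx z)).
  by apply/funext => y; rewrite /tangent_chart row_mxEl.
have chr (b : 'I_n) : \near z, tangent_chart j (tangent_chart_inv i z) 0 (rshift n b) =
    complete_lift (transition_coord i j b) z.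
  have oV : open (tangent_cod i `&` tangent_chart_inv i @^-1` tangent_dom j).
    exact: tangent_dom_open.
  have Vz : (tangent_cod i `&` tangent_chart_inv i @^-1` tangent_dom j) z.
    by case: Uz.
  apply: filterS (open_nbhs_nbhs (conj oV Vz)) => y Vy.
  rewrite tangent_transitionE// row_mxEr.
  have dt := transition_differentiable Vy.
  rewrite derive_entry; last exact: diff_derivable.
  rewrite complete_liftE//; exact: smooth_on_differentiable (smooth_transition_coord i j b) Vy.
apply/matrixP => a b; rewrite TJ.
case: (split_ordP b) => {}b ->; case: (split_ordP a) => {}a ->.
- rewrite chl block_mxEul JE; exact: derive_pullback_l.
- rewrite chl block_mxEdl mxE; exact: derive_pullback_r.
- rewrite (near_eq_derive _ (chr b)) block_mxEur mxE -lz -rz.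
  exact: derive_complete_lift_l (smooth_transition_coord i j b) Uz.
- rewrite (near_eq_derive _ (chr b)) block_mxEdr JE.
  exact: derive_complete_lift_r (smooth_transition_coord i j b) Uz.
Qed.

Lemma block_congruence (A D K H : 'M[R]_n) :
  (block_mx K H 0 K)^T *m block_mx 0 A A D *m block_mx K H 0 K =
  block_mx 0 (K^T *m A *m K) (K^T *m A *m K)
    (H^T *m A *m K + K^T *m A *m H + K^T *m D *m K).
Proof.
rewrite tr_block_mx trmx0 !mulmx_block !mulmx0 !mul0mx !add0r !addr0.
by rewrite !mul0mx add0r mulmxDl addrCA addrA.
Qed.

Lemma derive_comp_dir (f : E -> R) (g : E -> E) x v :
  differentiable g x -> differentiable f (g x) ->
  'D_v (f \o g) x = 'D_('D_v g x) f (g x).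
Proof. by move=> dg df; rewrite derive_comp// -(derive_basis _ df). Qed.

(** The components of P in chart i are products of the components in chart c and two
first derivatives of the transition map. Differentiating this product along y
gives three terms; symmetry of second derivatives identifies the outer ones with
the mixed block of the tangent Jacobian. *)
Lemma complete_lift_change P i w a b : bivector_field P ->
  chart_dom i (tangent_proj w) ->
  let p := tangent_proj w in let c := chart_at p in
  let A := bivector_coord P c (chart c p) in
  let K := J c i p in let H := transition_hessian c i p (tangent_coord c w) in
  let C := \matrix_(k, l) complete_lift (fun x => bivector_coord P c x k l) (tangent_chart c w) in
  complete_lift (fun x => bivector_coord P i x a b) (tangent_chart i w) =
  (H^T *m A *m K + K^T *m A *m H + K^T *m C *m K) a b.
Proof.
move=> PP ip p c A K H C.
have cp : chart_dom c p := chart_at_dom p.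
set x := chart c p; set v := tangent_coord c w.
have Ux : transition_domain c i x by exact: mem_transition_domain.
have SA j k l : smooth_on (chart_range j) (fun x => bivector_coord P j x k l).
  exact: smooth_entry (@chart_range_open _ _ M j) (PP.2 j).
pose t := transition_coord c i.
pose tau : E -> E := chart i \o chart_inv c.
have tx : tau x = chart i p by rewrite /tau /x /= chartK.
have dtau : differentiable tau x by exact: transition_differentiable.
have vK : tangent_coord i w = 'D_v tau x.
  rewrite (deriveEjacobian _ dtau) /v /tangent_coord -/p -/c.
  by rewrite (transition_jacobian_id cp) mulmx1.
have dA : differentiable (fun x => bivector_coord P i x a b) (tau x).
  by rewrite tx; exact: smooth_on_differentiable (SA i a b) (chart_in_range ip).
have -> : complete_lift (fun x => bivector_coord P i x a b) (tangent_chart i w) =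
    'D_v ((fun x => bivector_coord P i x a b) \o tau) x.
  apply: etrans (esym (derive_comp_dir _ dtau dA)).
  rewrite complete_liftE /tangent_chart row_mxKl; last by rewrite -tx.
  rewrite row_mxKr.
  have D_congr (F : E -> R) (u u' y y' : E) : u = u' -> y = y' -> 'D_u F y = 'D_u' F y'.
    by move=> -> ->.
  exact: D_congr vK (esym tx).
have congE (X Y Z : 'M[R]_n) : (X^T *m Y *m Z) a b = \sum_k \sum_l X k a * Y k l * Z l b.
  rewrite mxE exchange_big; apply: eq_bigr => l _; rewrite mxE mulr_suml.
  by apply: eq_bigr => k _; rewrite [in LHS]mxE.
have expand : \near x, ((fun x => bivector_coord P i x a b) \o tau) x =
    \sum_k \sum_l d k (t a) x * bivector_coord P c x k l * d l (t b) x.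
  apply: filterS (open_nbhs_nbhs (conj (@transition_domain_open c i) Ux)) => y [cy iy].
  have EP := bivector_coord_change P (chart_inv_dom cy) iy.
  rewrite (chart_invK cy) in EP.
  change (bivector_coord P i (chart i (chart_inv c y)) a b =
    \sum_k \sum_l d k (t a) y * bivector_coord P c y k l * d l (t b) y).
  rewrite EP; apply: etrans (congE _ _ _) _.
  apply: eq_bigr => k _; apply: eq_bigr => l _.
  have TE1 e f := @transition_jacobianE _ _ M c i _ e f (chart_inv_dom cy) iy.
  by rewrite (TE1 k a) (TE1 l b) (chart_invK cy).
rewrite (near_eq_derive _ expand).
have KE k l : K k l = d k (t l) x by exact: transition_jacobianE.
have HE k l : H k l = 'D_v (d k (t l)) x.
  rewrite mxE derive_basis; last first.
    exact: smooth_on_differentiable (smooth_derive k (smooth_transition_coord c i l)) Ux.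
  apply: eq_bigr => s _.
  exact: (f_equal (fun r => v 0 s * r) (derive_basisC k s (@transition_domain_open c i)
    (smooth_transition_coord c i l 2%N) Ux)).
have CE k l : C k l = 'D_v (fun x => bivector_coord P c x k l) x.
  rewrite mxE complete_liftE /tangent_chart row_mxKl ?row_mxKr//.
  exact: smooth_on_differentiable (SA c k l) (chart_in_range cp).
have D k l : is_derive x v (fun x => d k (t a) x * bivector_coord P c x k l * d l (t b) x)
    (H k a * A k l * K l b + K k a * C k l * K l b + K k a * A k l * H l b).
  rewrite !KE !HE CE; apply: is_derive_prod3; apply: derivableP.
  - exact: smooth_derivable (smooth_derive k (smooth_transition_coord c i a)) Ux.
  - exact: smooth_derivable (SA c k l) (chart_in_range cp).
  - exact: smooth_derivable (smooth_derive l (smooth_transition_coord c i b)) Ux.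
rewrite derive_fsum; last first.
  by move=> k; apply: derivable_fsum => l; exact: (@ex_derive _ _ _ _ _ _ _ (D k l)).
have addE (X Y Z : 'M[R]_n) : (X + Y + Z) a b = X a b + Y a b + Z a b by rewrite !mxE.
apply: etrans (esym (addE _ _ _)).
apply: etrans (esym (f_equal2 +%R (f_equal2 +%R (congE H A K) (congE K A H)) (congE K C K))).
rewrite -!big_split /=; apply: eq_bigr => k _.
rewrite derive_fsum; last first.
  by move=> l; exact: (@ex_derive _ _ _ _ _ _ _ (D k l)).
rewrite -!big_split /=; apply: eq_bigr => l _.
by rewrite (@derive_val _ _ _ _ _ _ _ (D k l)) addrAC.
Qed.

(** Tensors are given at w by their components in the chart selected there, which fixes this
definition; [tangent_deformation_coord] extends the formula to every induced chart. *)
Definition tangent_deformation P B w : 'M[R]_(n + n) :=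
  let c := chart_at (tangent_proj w) in
  tangent_block (bivector_coord P c) (bivector_coord B c) (tangent_chart c w).

Lemma tangent_block_chart (A D : E -> 'M[R]_n) i w :
  let x := chart i (tangent_proj w) in let z := tangent_chart i w in
  tangent_block A D z = block_mx 0 (A x) (A x)
    (\matrix_(a, b) complete_lift (fun x => A x a b) z + D x).
Proof. by move=> x z; rewrite /tangent_block row_mxKl. Qed.

Lemma tangent_deformation_congruence P B i w : bivector_field P ->
  chart_dom i (tangent_proj w) ->
  let T := transition_jacobian (M := TM) (chart_at (tangent_proj w)) i w in
  T^T *m tangent_deformation P B w *m T =
  tangent_block (bivector_coord P i) (bivector_coord B i) (tangent_chart i w).
Proof.
move=> PP ip T; set p := tangent_proj w; set c := chart_at p.
have cp : chart_dom c p := chart_at_dom p.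
have TE : T = block_mx (J c i p) (transition_hessian c i p (tangent_coord c w)) 0 (J c i p).
  exact: tangent_jacobianE cp ip.
rewrite TE; apply: etrans (f_equal (fun Q => _^T *m Q *m _)
  (tangent_block_chart (bivector_coord P c) (bivector_coord B c) c w)) _.
apply: etrans (block_congruence _ _ _ _) _.
apply: esym; apply: etrans (tangent_block_chart _ _ _ _) _.
have PE := bivector_coord_change P cp ip; have BE := bivector_coord_change B cp ip.
rewrite -/p PE BE; congr (block_mx _ _ _ _).
rewrite mulmxDr mulmxDl addrA; congr (_ + _).
apply/matrixP => a b; rewrite [LHS]mxE.
exact: complete_lift_change.
Qed.

Lemma tangent_deformation_coord P B i z : bivector_field P -> tangent_cod i z ->
  bivector_coord (M := TM) (tangent_deformation P B) i z =
  tangent_block (bivector_coord P i) (bivector_coord B i) z.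
Proof.
move=> PP cz; have iw : tangent_dom i (tangent_chart_inv i z) by exact: chart_inv_dom.
apply: etrans (tangent_deformation_congruence B PP iw) _.
by rewrite tangent_chart_invK.
Qed.

End TangentCharts.

(** * Deformations of the tangent Poisson tensor *)

Section TangentDeformation.
Variables (R : realType) (n : nat) (M : manifold R n).
Local Notation E := 'rV[R]_n.
Local Notation TE := 'rV[R]_(n + n).
Local Notation TM := (tangent_bundle M).
Local Notation d k f := ('D_(basis_rV R k) f).
Implicit Types (i : chart_index M) (p : M) (w : TM) (P B : M -> 'M[R]_n) (z : TE).

Lemma Ck_on_lsubmx (V : normedModType R) r (U : set E) (f : E -> V) : open U ->
  Ck_on r U f -> Ck_on r ([set z : TE | U (lsubmx z)]) (fun z : TE => f (lsubmx z)).
Proof.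
move=> oU Cf; pose L : {linear TE -> E} := lsubmx.
have Lc : continuous L by exact: continuous_lsubmx.
exact: (Ck_on_comp_linear oU Lc Cf).
Qed.

Lemma open_lsubmx (U : set E) : open U -> open [set z : TE | U (lsubmx z)].
Proof. by move=> oU; apply: open_comp => // z _; exact: continuous_lsubmx. Qed.

Lemma smooth_complete_lift (U : set E) (f : E -> R) : open U -> smooth_on U f ->
  smooth_on [set z : TE | U (lsubmx z)] (complete_lift f).
Proof.
move=> oU Sf r; have oV := open_lsubmx oU.
apply: Ck_on_sum => // s; apply: Ck_onM => //.
  have -> : (fun z : TE => rsubmx z 0 s) = (fun z => z 0 (rshift n s)).
    by apply/funext => y; rewrite mxE.
  by apply: Ck_on_coord => //; exact: Ck_on_id.
exact: Ck_on_lsubmx oU (smooth_derive s Sf r).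
Qed.

Lemma smooth_tangent_block (U : set E) (A D : E -> 'M[R]_n) : open U ->
  smooth_on U A -> smooth_on U D ->
  smooth_on [set z : TE | U (lsubmx z)] (tangent_block A D).
Proof.
move=> oU SA SD r; have oV := open_lsubmx oU.
have SAe a b : Ck_on r [set z : TE | U (lsubmx z)] (fun z => A (lsubmx z) a b).
  exact: (Ck_on_lsubmx oU (smooth_entry a b oU SA r)).
apply/(Ck_on_mxP _ _ oV) => a b.
case: (split_ordP a) => {}a ->; case: (split_ordP b) => {}b ->.
- rewrite (funext (tangent_block_ll A D a b)); exact: Ck_on_cst.
- rewrite (funext (tangent_block_lr A D a b)); exact: SAe.
- rewrite (funext (tangent_block_rl A D a b)); exact: SAe.
- rewrite (funext (tangent_block_rr A D a b)); apply: Ck_onD => //.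
    exact: smooth_complete_lift oU (smooth_entry a b oU SA) r.
  exact: (Ck_on_lsubmx oU (smooth_entry a b oU SD r)).
Qed.

Lemma antisymE m (Y : 'M[R]_m) a b : Y^T = - Y -> Y a b = - Y b a.
Proof. by move=> /matrixP/(_ b a); rewrite !mxE. Qed.

Lemma complete_lift_antisym P i z a b : bivector_field P -> chart_range i (lsubmx z) ->
  complete_lift (fun x => bivector_coord P i x a b) z =
  - complete_lift (fun x => bivector_coord P i x b a) z.
Proof.
move=> PP cz; rewrite -sumrN; apply: eq_bigr => s _; rewrite -mulrN; congr (_ * _).
have oi := @chart_range_open _ _ M i.
have D : derivable (fun x => bivector_coord P i x b a) (lsubmx z) (basis_rV R s).
  exact: smooth_derivable (smooth_entry b a oi (PP.2 i)) cz.
apply: etrans (deriveN D); congr ('D_(basis_rV R s) _ (lsubmx z)).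
by apply/funext => x; apply: antisymE; exact: bivector_coord_antisym.
Qed.

Lemma tangent_deformation_bivector P B : bivector_field P -> bivector_field B ->
  bivector_field (M := TM) (tangent_deformation P B).
Proof.
move=> PP BB; split=> [w|i r].
  rewrite /tangent_deformation /tangent_block.
  rewrite tr_block_mx opp_block_mx oppr0 trmx0 !bivector_coord_antisym//.
  congr (block_mx _ _ _ _); rewrite linearD/= bivector_coord_antisym// opprD; congr (_ + _).
  apply/matrixP => a b; rewrite !mxE; apply: complete_lift_antisym PP _.
  by rewrite row_mxKl; exact/chart_in_range/chart_at_dom.
apply: (Ck_on_ext (@tangent_cod_open _ _ M i)) => [z cz|].
  by apply: esym; exact: tangent_deformation_coord.
exact: (smooth_tangent_block (@chart_range_open _ _ M i) (PP.2 i) (BB.2 i) r).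
Qed.

Lemma eq_cyclic_schouten m (A A' : 'rV[R]_m -> 'M[R]_m) x a b c :
  (\near x, A x = A' x) -> cyclic_schouten A A x a b c = cyclic_schouten A' A' x a b c.
Proof.
move=> AA; have AAx := nbhs_singleton AA.
have E (i j k : 'I_m) : schouten_term A A x i j k = schouten_term A' A' x i j k.
  apply: eq_bigr => s _; rewrite AAx; congr (_ * _); apply: near_eq_derive.
  by apply: filterS AA => y ->.
by rewrite /cyclic_schouten !E.
Qed.

(** Near w the components in one induced chart are a block bivector, so the local
computation applies; the local identities for P come from its Jacobi identity. *)
Lemma tangent_deformation_poisson P B : poisson_tensor P -> bivector_field B ->
  (forall p a b c, let i := chart_at p in let x := chart i p in
     cyclic_schouten (bivector_coord P i) (bivector_coord B i) x a b c
     + cyclic_schouten (bivector_coord B i) (bivector_coord P i) x a b c = 0) ->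
  poisson_tensor (M := TM) (tangent_deformation P B).
Proof.
move=> HP BB PB; have PP := HP.1.
apply: jacobi_of_chart_at; first exact: tangent_deformation_bivector.
move=> w a b c A; set i := chart_at (tangent_proj w).
have iw : chart_dom i (tangent_proj w) := chart_at_dom (tangent_proj w).
have cz : tangent_cod i (tangent_chart i w) by exact: tangent_chart_cod.
have nearE : \forall z \near tangent_chart i w,
    A z = tangent_block (bivector_coord P i) (bivector_coord B i) z.
  apply: filterS (open_nbhs_nbhs (conj (@tangent_cod_open _ _ M i) cz)) => z.
  exact: tangent_deformation_coord.
apply: etrans (eq_cyclic_schouten a b c nearE) _.
apply: (jacobi_tangent_block (U := chart_range i)).
- exact: chart_range_open.
- exact: PP.2.
- exact: BB.2.
- exact: cz.
- by move=> x a' b' c'; exact: poisson_tensor_coord.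
- by move=> a' b' c'; rewrite row_mxKl; exact: PB.
Qed.

Lemma wedge_congr (u v : E) (K : 'M[R]_n) :
  K^T *m wedge u v *m K = wedge (u *m K) (v *m K).
Proof. by rewrite /wedge mulmxBr mulmxBl !trmx_mul !mulmxA. Qed.

Lemma tr_wedge m (u v : 'rV[R]_m) : (wedge u v)^T = - wedge u v.
Proof. by rewrite /wedge linearB /= !trmx_mul !trmxK opprB. Qed.

Definition wedge_deformation (f : M -> R) (X1 X2 X3 X4 : M -> E) p : 'M[R]_n :=
  f p *: (wedge (X1 p) (X2 p) + wedge (X3 p) (X4 p)).

Lemma wedge_deformation_coord f X1 X2 X3 X4 i :
  bivector_coord (wedge_deformation f X1 X2 X3 X4) i =
  fun x => f (chart_inv i x) *:
    (wedge (vector_coord X1 i x) (vector_coord X2 i x)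
     + wedge (vector_coord X3 i x) (vector_coord X4 i x)).
Proof.
apply/funext => x; rewrite /bivector_coord /wedge_deformation.
by rewrite -scalemxAr -scalemxAl mulmxDr mulmxDl !wedge_congr.
Qed.

Lemma smooth_wedge (U : set E) (X Y : E -> E) : open U -> smooth_on U X -> smooth_on U Y ->
  smooth_on U (fun x => wedge (X x) (Y x)).
Proof.
move=> oU SX SY r; apply/(Ck_on_mxP _ _ oU) => a b.
have -> : (fun x => wedge (X x) (Y x) a b) =
    (fun x => X x 0 a * Y x 0 b + - (Y x 0 a * X x 0 b)).
  by apply/funext => x; rewrite /wedge !mxE !big_ord1 !mxE.
have SXc a' : Ck_on r U (fun x => X x 0 a') by exact: Ck_on_coord.
have SYc a' : Ck_on r U (fun x => Y x 0 a') by exact: Ck_on_coord.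
by apply: Ck_onD => //; [|apply: Ck_onN => //]; apply: Ck_onM.
Qed.

Lemma wedge_deformation_bivector f X1 X2 X3 X4 : smooth_function f ->
  vector_field X1 -> vector_field X2 -> vector_field X3 -> vector_field X4 ->
  bivector_field (wedge_deformation f X1 X2 X3 X4).
Proof.
move=> Sf S1 S2 S3 S4; split=> [p|i r].
  by rewrite /wedge_deformation linearZ/= linearD/= !tr_wedge -opprD scalerN.
rewrite wedge_deformation_coord; have oi := @chart_range_open _ _ M i.
apply: Ck_onZ => //; first exact: (Sf i).
by apply: Ck_onD => //; apply: smooth_wedge.
Qed.

Lemma sum_isolate (x dA Asb Abs Aas u v : 'I_n -> R) : (forall s, Asb s = - Abs s) ->
  \sum_s (x s * dA s - Asb s * u s - Aas s * v s) = 0 ->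
  \sum_s x s * dA s = \sum_s Aas s * v s - \sum_s Abs s * u s.
Proof.
move=> AN H; apply/eqP; rewrite -subr_eq0 -!sumrB; apply/eqP; rewrite -[RHS]H.
by apply: eq_bigr => s _; rewrite AN; ring.
Qed.

(** At the point itself the components of X in the selected chart are X p, so the
vanishing of the Lie derivative can be read in that chart. *)
Lemma poisson_vector_field_lie_derivative P X p : bivector_field P ->
  poisson_vector_field P X ->
  let i := chart_at p in
  lie_derivative_vanishes_at (bivector_coord P i) (vector_coord X i) (chart i p).
Proof.
move=> PP [_ LX] i a b; have ip : chart_dom i p := chart_at_dom p.
have Xp : vector_coord X i (chart i p) = X p.
  by rewrite /vector_coord chartK// transition_jacobian_id// mulmx1.
have /matrixP/(_ a b) := LX p; rewrite [LHS]mxE [RHS]mxE Xp /anchor_derivative bivector_coord_at.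
apply: sum_isolate => s; exact: antisymE (PP.1 p).
Qed.

Lemma wedge_deformation_compatible P (f : M -> R) X1 X2 X3 X4 p a b c :
  bivector_field P -> casimir P f ->
  poisson_vector_field P X1 -> poisson_vector_field P X2 ->
  poisson_vector_field P X3 -> poisson_vector_field P X4 ->
  let i := chart_at p in let x := chart i p in
  let A := bivector_coord P i in
  let D := bivector_coord (wedge_deformation f X1 X2 X3 X4) i in
  cyclic_schouten A D x a b c + cyclic_schouten D A x a b c = 0.
Proof.
move=> PP Cf P1 P2 P3 P4 i x A D.
have oi := @chart_range_open _ _ M i.
have cx : chart_range i x := chart_in_range (chart_at_dom p).
have dV X : poisson_vector_field P X -> differentiable (vector_coord X i) x.
  by move=> PX; exact: smooth_on_differentiable (PX.1 i) cx.
have dW X Y : poisson_vector_field P X -> poisson_vector_field P Y ->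
    differentiable (fun x => wedge (vector_coord X i x) (vector_coord Y i x)) x.
  by move=> PX PY; exact: smooth_on_differentiable (smooth_wedge oi (PX.1 i) (PY.1 i)) cx.
rewrite /D wedge_deformation_coord.
apply: (casimir_scale_compatible (f := f \o chart_inv i)).
- exact: smooth_on_differentiable (Cf.1 i) cx.
- by apply: differentiableD; exact: dW.
- by move=> s; exact: casimir_coord Cf cx.
have compat X Y : poisson_vector_field P X -> poisson_vector_field P Y ->
    let W x := wedge (vector_coord X i x) (vector_coord Y i x) in
    cyclic_schouten A W x a b c + cyclic_schouten W A x a b c = 0.
  move=> PX PY; apply: wedge_compatible; [exact: dV|exact: dV| |];
    exact: poisson_vector_field_lie_derivative.
by apply: schouten_compatibleD; [exact: dW|exact: dW|exact: compat|exact: compat].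
Qed.

Lemma wedge_row_mx0 (u v : E) :
  wedge (row_mx 0 u : TE) (row_mx 0 v) = block_mx 0 0 0 (wedge u v).
Proof.
rewrite /wedge !tr_row_mx !mul_col_row !trmx0 !mulmx0 !mul0mx.
by rewrite opp_block_mx add_block_mx !subr0.
Qed.

Lemma block_mx_sum_delta (Aul Aur Adl Adr : 'M[R]_n) :
  block_mx Aul Aur Adl Adr =
  \sum_a \sum_b Aul a b *: delta_mx (lshift n a) (lshift n b)
  + \sum_a \sum_b Aur a b *: delta_mx (lshift n a) (rshift n b)
  + (\sum_a \sum_b Adl a b *: delta_mx (rshift n a) (lshift n b)
     + \sum_a \sum_b Adr a b *: delta_mx (rshift n a) (rshift n b)).
Proof.
rewrite [LHS]matrix_sum_delta big_split_ord.
rewrite -[X in _ = X + _]big_split -[X in _ = _ + X]big_split /=.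
by congr (_ + _); apply: eq_bigr => a _; rewrite big_split_ord; congr (_ + _);
  apply: eq_bigr => b _; rewrite ?block_mxEul ?block_mxEur ?block_mxEdl ?block_mxEdr.
Qed.

Lemma sum_zero_coef (V : lmodType R) (F : 'I_n -> 'I_n -> V) :
  \sum_a \sum_b (0 : 'M[R]_n) a b *: F a b = 0.
Proof. by rewrite big1// => a _; rewrite big1// => b _; rewrite mxE scale0r. Qed.

Lemma wedge_basis m (k l : 'I_m) :
  wedge (basis_rV R k) (basis_rV R l) = delta_mx k l - delta_mx l k.
Proof. by rewrite /wedge /basis_rV !trmx_delta !mul_delta_mx. Qed.

Lemma sum_wedge_lr (N : 'M[R]_n) : N^T = - N ->
  \sum_a \sum_b N a b *: wedge (basis_rV R (lshift n a)) (basis_rV R (rshift n b)) =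
  block_mx 0 N N 0.
Proof.
move=> NN; rewrite block_mx_sum_delta !sum_zero_coef add0r addr0.
rewrite [X in _ = _ + X]exchange_big -big_split; apply: eq_bigr => a _ /=.
rewrite -big_split; apply: eq_bigr => b _ /=.
by rewrite wedge_basis scalerBr (antisymE b a NN) scaleNr.
Qed.

Lemma sum_wedge_rr (N : 'M[R]_n) : N^T = - N ->
  2^-1 *: (\sum_a \sum_b N a b *: wedge (basis_rV R (rshift n a)) (basis_rV R (rshift n b))) =
  block_mx 0 0 0 N.
Proof.
move=> NN; pose S := \sum_a \sum_b N a b *: delta_mx (rshift n a) (rshift n b) : 'M[R]_(n + n).
have -> : block_mx 0 0 0 N = S.
  by rewrite block_mx_sum_delta !sum_zero_coef !add0r.
have -> : \sum_a \sum_b N a b *: wedge (basis_rV R (rshift n a)) (basis_rV R (rshift n b)) =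
    S + S.
  rewrite /S [X in _ = _ + X]exchange_big -big_split; apply: eq_bigr => a _ /=.
  rewrite -big_split; apply: eq_bigr => b _ /=.
  by rewrite wedge_basis scalerBr (antisymE b a NN) scaleNr.
have half2 : 2^-1 + 2^-1 = 1 :> R by lra.
by rewrite scalerDr -scalerDl half2 scale1r.
Qed.

(** The sum over d_x /\ d_y fills both off-diagonal blocks with pi, because pi is
antisymmetric; the factor 1/2 compensates the double counting in the sum over
d_y /\ d_y. *)
Lemma tangent_poissonE P w : bivector_field P ->
  tangent_poisson P w =
  let c := chart_at (tangent_proj w) in
  tangent_block (bivector_coord P c) (fun=> 0) (tangent_chart c w).
Proof.
move=> PP; set c := chart_at (tangent_proj w); rewrite [RHS]/=.
have cp : chart_dom c (tangent_proj w) := chart_at_dom (tangent_proj w).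
rewrite tangent_block_chart addr0; set N := \matrix_(a, b) _.
have NE (a b : 'I_n) : \sum_s d s (fun x => bivector_coord P c x a b) (chart c (tangent_proj w))
     * tangent_coord c w 0 s = N a b.
  rewrite mxE /complete_lift /tangent_chart row_mxKl row_mxKr.
  by apply: eq_bigr => s _; rewrite mulrC.
have NN : N^T = - N.
  apply/matrixP => a b; rewrite !mxE; apply: complete_lift_antisym PP _.
  by rewrite row_mxKl; exact: chart_in_range.
rewrite /tangent_poisson /tangent_poisson_coord -/c sum_wedge_lr; last first.
  exact: bivector_coord_antisym.
under eq_bigr do under eq_bigr do rewrite -scaler_suml NE.
by rewrite sum_wedge_rr// add_block_mx !addr0 add0r.
Qed.

Lemma tangent_deformation_wedgeE P (f : M -> R) X1 X2 X3 X4 w : bivector_field P ->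
  tangent_poisson P w + f (tangent_proj w) *:
    (wedge (vertical_lift X1 w) (vertical_lift X2 w)
     + wedge (vertical_lift X3 w) (vertical_lift X4 w)) =
  tangent_deformation P (wedge_deformation f X1 X2 X3 X4) w.
Proof.
move=> PP; rewrite tangent_poissonE//= /vertical_lift !wedge_row_mx0.
rewrite add_block_mx scale_block_mx /tangent_deformation !tangent_block_chart.
rewrite add_block_mx !addr0 !scaler0 !addr0; congr (block_mx _ _ _ (_ + _)).
by rewrite bivector_coord_at.
Qed.

Lemma poisson_deformation P (f : M -> R) X1 X2 X3 X4 :
  poisson_tensor P -> casimir P f ->
  poisson_vector_field P X1 -> poisson_vector_field P X2 ->
  poisson_vector_field P X3 -> poisson_vector_field P X4 ->
  poisson_tensor (fun w : TM => tangent_poisson P w + f (tangent_proj w) *: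
    (wedge (vertical_lift X1 w) (vertical_lift X2 w)
     + wedge (vertical_lift X3 w) (vertical_lift X4 w))).
Proof.
move=> HP Cf P1 P2 P3 P4; have PP := HP.1.
rewrite (_ : (fun w => _) = tangent_deformation P (wedge_deformation f X1 X2 X3 X4)); last first.
  by apply/funext => w; exact: tangent_deformation_wedgeE.
apply: tangent_deformation_poisson => //.
  exact: wedge_deformation_bivector Cf.1 P1.1 P2.1 P3.1 P4.1.
by move=> p a b c; exact: wedge_deformation_compatible.
Qed.

Lemma casimirZ P (l : R) f : casimir P f -> casimir P (fun p => l * f p).
Proof.
move=> [Sf Cf]; have Sl i : smooth_on (chart_range i) ((fun p => l * f p) \o chart_inv i).
  by move=> r; apply: Ck_onM; [exact: chart_range_open|exact: Ck_on_cst|exact: Sf].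
split=> // g Sg p; rewrite -[RHS](mulr0 l) -(Cf g Sg p) /bracket mulr_sumr.
apply: eq_bigr => a _; rewrite mulr_sumr; apply: eq_bigr => b _.
have -> : partial (fun p => l * f p) p b = l * partial f p b.
  apply: (@deriveMl _ _ (f \o chart_inv (chart_at p))).
  exact: smooth_derivable (Sf _) (chart_in_range (chart_at_dom p)).
by rewrite mulrCA.
Qed.

Lemma bivector_coord0 i : bivector_coord (fun=> 0) i = (fun=> 0) :> (E -> 'M[R]_n).
Proof. by apply/funext => x; rewrite /bivector_coord mulmx0 mul0mx. Qed.

(** For the zero Poisson tensor every function is a Casimir function, every vector field is
Poisson, and the lift to the tangent bundle is zero. A sum of wedges of vertical lifts
is therefore the deformation of the zero tensor with c = 1. *)
Lemma poisson_tensor0 : poisson_tensor (fun=> 0 : 'M[R]_n) (M := M).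
Proof.
have br0 f g p : bracket (fun=> 0 : 'M[R]_n) f g p = 0 :> R.
  by rewrite /bracket big1// => a _; rewrite big1// => b _; rewrite mxE !mul0r.
split=> [|f g h _ _ _ p]; last by rewrite !br0 !addr0.
split=> [p|i r]; first by rewrite trmx0 oppr0.
rewrite bivector_coord0; exact: Ck_on_cst.
Qed.

Lemma casimir_cst : casimir (fun=> 0 : 'M[R]_n) (fun=> 1 : R) (M := M).
Proof.
split=> [i r|f _ p]; first exact: Ck_on_cst.
by rewrite /bracket big1// => a _; rewrite big1// => b _; rewrite mxE !mul0r.
Qed.

Lemma vector_field_poisson0 X : vector_field X ->
  poisson_vector_field (fun=> 0 : 'M[R]_n) X (M := M).
Proof.
move=> SX; split=> // p; apply/matrixP => a b; rewrite [LHS]mxE [RHS]mxE big1// => s _.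
have -> : (fun x => bivector_coord (fun=> 0 : 'M[R]_n) (chart_at p) x a b) = cst 0.
  by apply/funext => x; rewrite bivector_coord0 mxE.
by rewrite derive_cst mulr0 !mxE !mul0r !subr0.
Qed.

Lemma tangent_poisson0 w : tangent_poisson (fun=> 0 : 'M[R]_n) w = 0.
Proof.
rewrite tangent_poissonE; last exact: poisson_tensor0.1.
rewrite /= bivector_coord0 /tangent_block -[RHS]block_mx0 addr0; congr (block_mx _ _ _ _).
apply/matrixP => a b; rewrite [LHS]mxE [RHS]mxE /complete_lift big1// => s _.
have -> : (fun z : E => (0 : 'M[R]_n) a b) = cst 0 by apply/funext => z; rewrite mxE.
by rewrite derive_cst mulr0.
Qed.

End TangentDeformation.

Theorem theorem8 (R : realType) (n : nat) (M : manifold R n) :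
  (forall X1 X2 X3 X4 : M -> 'rV[R]_n,
     vector_field X1 -> vector_field X2 -> vector_field X3 -> vector_field X4 ->
     poisson_tensor (fun w : tangent_bundle M =>
       wedge (vertical_lift X1 w) (vertical_lift X2 w) +
       wedge (vertical_lift X3 w) (vertical_lift X4 w)))
  /\
  (forall (pi : M -> 'M[R]_n) (c : M -> R) (lambda : R)
          (X1 X2 X3 X4 : M -> 'rV[R]_n),
     poisson_tensor pi -> casimir pi c ->
     poisson_vector_field pi X1 -> poisson_vector_field pi X2 ->
     poisson_vector_field pi X3 -> poisson_vector_field pi X4 ->
     poisson_tensor (fun w : tangent_bundle M =>
       tangent_poisson pi w +
       (lambda * c (tangent_proj w)) *:
         (wedge (vertical_lift X1 w) (vertical_lift X2 w) +
          wedge (vertical_lift X3 w) (vertical_lift X4 w)))).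
Proof.
split=> [X1 X2 X3 X4 S1 S2 S3 S4|pi c lambda X1 X2 X3 X4 HP Cc P1 P2 P3 P4].
  have := poisson_deformation (poisson_tensor0 M) (casimir_cst M)
    (vector_field_poisson0 S1) (vector_field_poisson0 S2)
    (vector_field_poisson0 S3) (vector_field_poisson0 S4).
  congr (poisson_tensor _); apply/funext => w.
  by rewrite tangent_poisson0 add0r scale1r.
exact: (poisson_deformation HP (casimirZ lambda Cc) P1 P2 P3 P4).
Qed.
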